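(* Let $n\ge 4$ be an integer, let $G$ be a graph, and let $G_1,G_2$ be subgraphs of the same component of $G$, each belonging to $\delta_n$ (that is, each isomorphic to a graph $G^r_m$ with $r+m=n$). If $G_1\ne G_2$, then the sequence $\{HL^k(G)\}_{k\ge 0}$, taken with $H\cong P_n$, diverges by order.
   Context: All graphs are finite, simple and undirected. $P_n$ is the path on $n$ vertices. Fix $H\cong P_n$. Two edges of a graph $G$ are $P_n$-adjacent if they are distinct, share an endpoint, and both lie in a common subgraph of $G$ isomorphic to $P_n$. The graph $HL(G)$ has vertex set $E(G)$, with two vertices adjacent iff the corresponding edges are $P_n$-adjacent in $G$ (if $G$ has no edges, $HL(G)$ is the graph with no vertices). Set $HL^0(G)=G$ and $HL^{k+1}(G)=HL(HL^k(G))$. The sequence of $G$ diverges by order if for every positive integer $N$ there is an integer $k$ with $|V(HL^k(G))|\ge N$. For integers $m\ge 3$ and $r\ge 1$, $G^r_m$ is the unicyclic graph of order $m+r$ obtained from a cycle of length $m$ and a disjoint path on $r$ vertices by adding one edge joining a vertex of the cycle to an end vertex of the path. $\delta_n$ is the set of graphs $G^r_m$ with $r+m=n$, considered up to isomorphism. Two subgraphs $G_1,G_2$ of $G$ are equal iff $V(G_1)=V(G_2)$ and $E(G_1)=E(G_2)$; so $G_1\neq G_2$ may hold even if $G_1\cong G_2$. *)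

(* Defs.v *)
From HB Require Import structures.
From mathcomp Require Import all_boot.

Set Implicit Arguments.
Unset Strict Implicit.
Unset Printing Implicit Defensive.

Record sgraph := SGraph {
  svertex :> finType;
  sedge : rel svertex;
  sedge_sym : symmetric sedge;
  sedge_irr : irreflexive sedge }.

Arguments sedge {s}.

Definition edges (G : sgraph) : {set {set G}} :=
  [set [set p.1; p.2] | p in [set p : G * G | sedge p.1 p.2]].

(* Boolean, so that [isomorphic] can occur inside an adjacency relation; g is
   the inverse of f, see [isomorphicP]. *)
Definition isomorphic (G K : sgraph) : bool :=
  [exists f : {ffun G -> K}, exists g : {ffun K -> G},
    [&& [forall x, g (f x) == x], [forall y, f (g y) == y]
      & [forall x, forall y, sedge (f x) (f y) == sedge x y]]].

Lemma isomorphicP (G K : sgraph) :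
  reflect (exists2 f : G -> K, bijective f & {mono f : x y / sedge x y})
          (isomorphic G K).
Proof.
apply: (iffP existsP) => [[f /existsP[g /and3P[fK gK fE]]]|[f [g fK gK] fE]].
  exists f.
    by exists g => x; apply/eqP; [apply: (forallP fK) | apply: (forallP gK)].
  by move=> x y; apply/eqP; apply: (forallP (forallP fE x)).
exists (finfun f); apply/existsP; exists (finfun g); apply/and3P; split.
- by apply/forallP => x; rewrite !ffunE fK.
- by apply/forallP => y; rewrite !ffunE gK.
- by apply/forallP => x; apply/forallP => y; rewrite !ffunE fE.
Qed.

Section Subgraphs.
Variable G : sgraph.

Definition subgraph_axiom (p : {set G} * {set {set G}}) : bool :=
  (p.2 \subset edges G) && [forall e in p.2, e \subset p.1].

(* As a subtype of pairs (V, E), two subgraphs are equal iff they have the same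
   vertex set and the same edge set. *)
Record subgraph := Subgraph {
  subgraph_val : {set G} * {set {set G}};
  _ : subgraph_axiom subgraph_val }.

HB.instance Definition _ := [isSub for subgraph_val].
HB.instance Definition _ := [Countable of subgraph by <:].
HB.instance Definition _ := [Finite of subgraph by <:].

Definition subV (S : subgraph) : {set G} := (subgraph_val S).1.
Definition subE (S : subgraph) : {set {set G}} := (subgraph_val S).2.

Definition sub_edge (S : subgraph) : rel {x : G | x \in subV S} :=
  fun x y => [set val x; val y] \in subE S.

Fact sub_edge_sym (S : subgraph) : symmetric (@sub_edge S).
Proof. by move=> x y; rewrite /sub_edge setUC. Qed.

Fact sub_edge_irr (S : subgraph) : irreflexive (@sub_edge S).
Proof.
move=> x; apply/negP => xS; have /andP[/subsetP sSG _] := valP S.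
have /imsetP[[a b]] := sSG _ xS; rewrite inE /= setUid => ab /setP eq_ab.
have := eq_ab a; have := eq_ab b; rewrite !inE !eqxx orbT /= => /eqP eb /eqP ea.
by move: ab; rewrite ea eb sedge_irr.
Qed.

Definition graph_of_subgraph (S : subgraph) : sgraph :=
  SGraph (@sub_edge_sym S) (@sub_edge_irr S).

(* Vertex sets of the connected components of G; a subgraph of G is a subgraph
   of a component as soon as its vertices lie in it, components being induced. *)
Definition components : {set {set G}} :=
  equivalence_partition (connect (@sedge G)) [set: G].

End Subgraphs.

Definition path_rel (n : nat) : rel 'I_n :=
  fun i j => (i.+1 == j) || (j.+1 == i).

Fact path_rel_sym n : symmetric (@path_rel n).
Proof. by move=> i j; rewrite /path_rel orbC. Qed.

Fact path_rel_irr n : irreflexive (@path_rel n).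
Proof. by move=> i; rewrite /path_rel orbb gtn_eqF. Qed.

Definition path_graph (n : nat) : sgraph :=
  SGraph (@path_rel_sym n) (@path_rel_irr n).

(* [ordS] is the cyclic successor; i != j only matters for m = 1. *)
Definition cycle_rel (m : nat) : rel 'I_m :=
  fun i j => (i != j) && ((ordS i == j) || (ordS j == i)).

(* G^r_m : the cycle on 'I_m and the path on 'I_r, with vertex 0 of the cycle
   joined to the end vertex 0 of the path. *)
Definition tadpole_rel (m r : nat) : rel ('I_m + 'I_r) :=
  fun u v => match u, v with
  | inl i, inl j => cycle_rel i j
  | inr i, inr j => path_rel i j
  | inl i, inr j | inr j, inl i => (i == 0 :> nat) && (j == 0 :> nat)
  end.

Fact tadpole_rel_sym m r : symmetric (@tadpole_rel m r).
Proof.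
move=> [i|i] [j|j] //=; last exact: path_rel_sym.
by rewrite /cycle_rel eq_sym orbC.
Qed.

Fact tadpole_rel_irr m r : irreflexive (@tadpole_rel m r).
Proof. by move=> [i|i] /=; rewrite ?path_rel_irr // /cycle_rel eqxx. Qed.

Definition tadpole (m r : nat) : sgraph :=
  SGraph (@tadpole_rel_sym m r) (@tadpole_rel_irr m r).

Definition in_delta (n : nat) (K : sgraph) : Prop :=
  exists m r : nat,
    [/\ 3 <= m, 1 <= r, r + m = n & isomorphic K (tadpole m r)].

Section HLineGraph.
Variables H G : sgraph.

Definition H_adjacent (e f : {set G}) : bool :=
  [&& e != f, e :&: f != set0
    & [exists S : subgraph G,
        [&& isomorphic (graph_of_subgraph S) H, e \in subE S & f \in subE S]]].

Definition HL_rel : rel {e : {set G} | e \in edges G} :=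
  fun e f => H_adjacent (val e) (val f).

Fact HL_rel_sym : symmetric HL_rel.
Proof.
move=> e f; rewrite /HL_rel /H_adjacent eq_sym setIC.
by congr [&& _, _ & _]; apply: eq_existsb => S; rewrite [X in _ && X]andbC.
Qed.

Fact HL_rel_irr : irreflexive HL_rel.
Proof. by move=> e; rewrite /HL_rel /H_adjacent eqxx. Qed.

Definition HL : sgraph := SGraph HL_rel_sym HL_rel_irr.

End HLineGraph.

Definition HL_iter (H : sgraph) (k : nat) (G : sgraph) : sgraph :=
  iter k (HL H) G.

Definition diverges_by_order (H G : sgraph) : Prop :=
  forall N : nat, 0 < N -> exists k : nat, N <= #|HL_iter H k G|.

(* Main.v *)
Require Import Defs.
From mathcomp Require Import all_boot zify.
Set Implicit Arguments.
Unset Strict Implicit.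
Unset Printing Implicit Defensive.

(** A path on n vertices puts consecutive edges into HL-adjacency, so a tadpole
    on n vertices with tail length r becomes in HL(G) a tadpole with tail length
    r - 1 whose vertices are the old edges, and finally an n-cycle; distinct
    tadpoles stay distinct because their edge sets differ.  They also stay
    connected: if two edge-disjoint n-vertex paths s and t meet, a Thomason-type
    parity argument produces another decomposition of their union, closed up by
    a new vertex, into two cycles; the longer of these yields a path with at
    least n vertices using edges of both s and t.  Once both tadpoles are
    n-cycles, every edge of the component lies on an n-vertex path, hence the
    component of HL(G) has at least as many vertices as the component of G has
    edges, and a connected graph with two cycles has more edges than vertices:
    the order grows at every step. *)

(** * Edges of paths and cycles *)

(** Adjacency in [HL] asks for a common path on exactly [n] vertices, so [HL] of a connected graph
    may fall apart; keeping both tadpoles in one component is the hard part. It suffices to find one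
    path with at least [n] vertices that shares an edge with each of two given [n]-vertex paths. For
    vertex-disjoint paths, longer halves are glued along a connecting path. When the paths cross,
    such halves may meet again and the gluing fails, so the length has to come from averaging:
    closed up, each path is a cycle with [n + 1] edges, and any other decomposition into two cycles
    has the same total. The parity argument runs on the union minus one segment, which joins the new
    vertex to a crossing vertex and has no inner vertex on the other cycle. What remains is a cycle
    plus a path between those two vertices, both of degree 3. Tadpoles are handled as vertex
    sequences [p ++ a :: q], because the edges of such a sequence, in order, form a sequence of the
    same kind in [HL]. *)

Section PathEdges.
Variable V : finType.
Implicit Types (x y z : V) (s t l r : seq V) (e : {set V}).

Fixpoint pedges s : seq {set V} :=
  if s is x :: s' then
    if s' is y :: _ then [set x; y] :: pedges s' else [::]
  else [::].

Definition cedges s := if s is x :: _ then pedges (rcons s x) else [::].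

Lemma pedges_cons2 x y s : pedges (x :: y :: s) = [set x; y] :: pedges (y :: s).
Proof. by []. Qed.

Lemma pedges_cat s x t : pedges (s ++ x :: t) = pedges (rcons s x) ++ pedges (x :: t).
Proof.
by elim: s => [|y [|z s] IH] //; rewrite !(cat_cons, rcons_cons, pedges_cons2) in IH *; rewrite IH.
Qed.

Lemma pedges_rcons2 s x y :
  pedges (rcons (rcons s x) y) = rcons (pedges (rcons s x)) [set x; y].
Proof. by rewrite -cats1 cat_rcons pedges_cat cats1. Qed.

Lemma pedges_rcons x0 s y :
  s != [::] -> pedges (rcons s y) = rcons (pedges s) [set last x0 s; y].
Proof. by case/lastP: s => // s x _; rewrite pedges_rcons2 last_rcons. Qed.

Lemma pedges_rev s : pedges (rev s) = rev (pedges s).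
Proof.
elim: s => // x [|y s] IH //.
rewrite pedges_cons2 [RHS]rev_cons -IH !rev_cons pedges_rcons2.
by rewrite setUC.
Qed.

Lemma size_pedges s : size (pedges s) = (size s).-1.
Proof. by elim: s => // x [|y s] // IH; rewrite pedges_cons2 /= IH. Qed.

Lemma pedgesP e s :
  reflect (exists l x y r, s = l ++ x :: y :: r /\ e = [set x; y]) (e \in pedges s).
Proof.
apply: (iffP idP) => [|[l [x [y [r [-> ->]]]]]]; last first.
  by rewrite pedges_cat mem_cat in_cons eqxx orbT.
elim: s => // x [|y s] IH //; rewrite pedges_cons2 in_cons => /predU1P[->|/IH].
  by exists [::], x, y, s.
by move=> [l [x' [y' [r [-> ->]]]]]; exists (x :: l), x', y', r.
Qed.

Lemma mem_pedges e s x : e \in pedges s -> x \in e -> x \in s.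
Proof.
case/pedgesP => [l [a [b [r [-> ->]]]]]; rewrite !inE mem_cat !inE.
by case/orP => ->; rewrite ?orbT.
Qed.

Lemma pedges_catl s t : {subset pedges s <= pedges (s ++ t)}.
Proof.
move=> e /pedgesP[l [x [y [r [-> ->]]]]]; apply/pedgesP.
by exists l, x, y, (r ++ t); rewrite -catA.
Qed.

Lemma pedges_catr s t : {subset pedges t <= pedges (s ++ t)}.
Proof.
move=> e /pedgesP[l [x [y [r [-> ->]]]]]; apply/pedgesP.
by exists (s ++ l), x, y, r; rewrite -catA.
Qed.

Lemma mem_pedges_nbr s x :
  x \in s -> 1 < size s -> exists2 y, y \in s & [set x; y] \in pedges s.
Proof.
case/splitPr => l [|y r] s_gt1; last first.
  exists y; first by rewrite mem_cat !inE eqxx !orbT.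
  by apply/pedgesP; exists l, x, y, r.
case/lastP: l s_gt1 => // l y _; exists y.
  by rewrite mem_cat mem_rcons inE eqxx.
by apply/pedgesP; exists l, y, x, [::]; rewrite cat_rcons setUC.
Qed.

Lemma count_head_pedges x y s : uniq (x :: y :: s) ->
  count (fun e => x \in e) (pedges (x :: y :: s)) = 1.
Proof.
move=> /andP[xNs _]; rewrite pedges_cons2 [count _ _]/= !inE eqxx add1n; congr _.+1.
apply/eqP; rewrite -leqn0 leqNgt -has_count; apply/hasPn => e ee.
by apply: contra xNs; apply: mem_pedges.
Qed.

Lemma uniq_pedges s : uniq s -> uniq (pedges s).
Proof.
elim: s => // x [|y s] IH // /andP[xNs us]; rewrite pedges_cons2 cons_uniq (IH us) andbT.
by apply: contra xNs => /mem_pedges; apply; rewrite !inE eqxx.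
Qed.

Lemma set2_inj x y z : [set x; y] = [set x; z] -> y = z.
Proof.
move=> E; have yE : y \in [set x; z] by rewrite -E !inE eqxx orbT.
have zE : z \in [set x; y] by rewrite E !inE eqxx orbT.
by move: yE zE; rewrite !inE => /orP[/eqP->|/eqP//] /orP[] /eqP.
Qed.

(** The only edge at [x] is the first one, so its other end, and inductively the whole path, can be
    read off; fixing the start excludes the reversed path. *)
Lemma pedges_inj x s t : uniq (x :: s) -> uniq (x :: t) ->
  perm_eq (pedges (x :: s)) (pedges (x :: t)) -> s = t.
Proof.
elim: s x t => [|y s IH] x [|z t] //.
- by move=> _ _ /perm_size.
- by move=> _ _ /perm_size.
move=> us ut pst; have /andP[_ us'] := us; have /andP[xNt ut'] := ut.
have : [set x; y] \in pedges (x :: z :: t).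
  by rewrite -(perm_mem pst) pedges_cons2 inE eqxx.
rewrite pedges_cons2 inE => /predU1P[/set2_inj yz|]; last first.
  by move=> /mem_pedges -/(_ x); rewrite !inE eqxx => /(_ isT) xt; rewrite inE xt in xNt.
subst z; congr cons; apply: (IH y) => //.
by move: pst; rewrite !pedges_cons2 perm_cons.
Qed.

Lemma cedges_rot x s y t : perm_eq (cedges (x :: s ++ y :: t)) (cedges (y :: t ++ x :: s)).
Proof.
rewrite /cedges !rcons_cons !rcons_cat !rcons_cons -!cat_cons.
by rewrite !pedges_cat perm_catC.
Qed.

Lemma cedgesE x s : cedges (x :: s) = rcons (pedges (x :: s)) [set last x s; x].
Proof. by rewrite /cedges (pedges_rcons x). Qed.

Lemma size_cedges s : size (cedges s) = size s.
Proof. by case: s => // x s; rewrite cedgesE size_rcons size_pedges. Qed.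

(** The common first edge fixes the orientation; without it the cycle is a path starting at [y], and
    [pedges_inj] applies. *)
Lemma cedges_inj x y s t : uniq (x :: y :: s) -> uniq (x :: y :: t) ->
  perm_eq (cedges (x :: y :: s)) (cedges (x :: y :: t)) -> s = t.
Proof.
move=> us ut; rewrite /cedges !rcons_cons !pedges_cons2 perm_cons => p.
have /pedges_inj : uniq (y :: rcons s x) by rewrite -rcons_cons rcons_uniq.
move=> /(_ (rcons t x)); rewrite -rcons_cons rcons_uniq.
by move/(_ ut p) => /rcons_inj [].
Qed.

End PathEdges.

Arguments pedges : simpl never.

(** * Parity of the number of fixed points of an involution *)

Section Parity.
Variable T : eqType.

Lemma even_size_involution (L : seq T) (f : T -> T) : uniq L ->
  {in L, forall x, [/\ f x \in L, f (f x) = x & f x != x]} -> ~~ odd (size L).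
Proof.
have [m] := ubnP (size L); elim: m L => // m IH [|x L] //= ltm /andP[xNL uL] fL.
have [fxL ffx fx] := fL x (mem_head _ _).
have {}fxL : f x \in L by move: fxL; rewrite inE (negPf fx).
have sz := size_rem fxL; have L_gt0 : 0 < size L by case: (L) fxL.
have -> : size L = (size (rem (f x) L)).+1 by rewrite sz prednK.
rewrite /= negbK; apply: IH; rewrite ?rem_uniq //; first by rewrite sz; lia.
move=> y; rewrite mem_rem_uniq // inE => /andP[yfx yL].
have [fyL ffy fy] := fL y (mem_behead (s := x :: L) yL); split=> //.
rewrite mem_rem_uniq // inE; apply/andP; split.
  by apply: contraNneq xNL => e; rewrite -ffx -e ffy.
by move: fyL; rewrite inE => /predU1P[e|//]; rewrite -e ffy eqxx in yfx.
Qed.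

(** Since [g] has no fixed point, [L] has even size; the points moved by [f] pair off, so the fixed
    points of [f] are even in number. *)
Lemma second_fixpoint (L : seq T) (f g : T -> T) (x : T) : uniq L ->
  {in L, forall x, f x \in L /\ f (f x) = x} ->
  {in L, forall x, [/\ g x \in L, g (g x) = x & g x != x]} ->
  x \in L -> f x = x -> exists y, [/\ y \in L, f y = y & y != x].
Proof.
move=> uL fL /(even_size_involution uL) evL xL fx.
have : ~~ odd (size [seq y <- L | f y != y]).
  apply: (@even_size_involution _ f); first exact: filter_uniq.
  move=> y; rewrite !mem_filter => /andP[fy yL]; have [fyL ffy] := fL y yL.
  by split; rewrite ?fyL ?ffy // andbT eq_sym.
have := count_predC (fun y => f y == y) L; rewrite size_filter => cE ev1.
have ev : ~~ odd (count (fun y => f y == y) L).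
  by move: evL; rewrite -cE oddD (negPf ev1) addbF.
rewrite -size_filter in ev.
have uF : uniq [seq y <- L | f y == y] by apply: filter_uniq.
have xF : x \in [seq y <- L | f y == y] by rewrite mem_filter fx eqxx.
have: has (predC1 x) [seq y <- L | f y == y].
  apply/negPn/negP => /hasPn allx.
  have eqF : [seq y <- L | f y == y] =i [:: x].
    move=> y; rewrite [RHS]inE; apply/idP/eqP => [yF|-> //].
    by have := allx y yF; rewrite /= negbK => /eqP.
  by move: ev; rewrite (perm_size (uniq_perm uF _ eqF)).
by case/hasP => y; rewrite mem_filter => /andP[/eqP fy yL] yx; exists y.
Qed.

End Parity.

(** * Lollipops *)

Section Lollipop.
(** [hu] and [hv] are the two-vertex beginnings imposed on the paths that start at [u] and at
    [v]. *)
Variables (V : finType) (u v : V) (hu hv : seq V) (E : seq {set V}).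

Hypothesis uNv : u != v.
Hypothesis headu : forall s : seq V, head u (hu ++ s) = u.
Hypothesis headv : forall s : seq V, head u (hv ++ s) = v.
Hypothesis size_hu : size hu = 2.
Hypothesis size_hv : size hv = 2.
Hypothesis degu : count (fun e : {set V} => u \in e) E = 3.
Hypothesis degv : count (fun e : {set V} => v \in e) E = 3.
Hypothesis loopless : forall x, [set x; x] \notin E.

(* X and Y, with the edge joining their ends, decompose E.  Their first edges
   are prescribed: without that the fixed points of the rotation would come in
   trivial pairs. *)
Definition lollipop (p : seq V * seq V) :=
  [&& uniq p.1, uniq p.2,
      perm_eq (pedges p.1 ++ rcons (pedges p.2) [set last u p.1; last u p.2]) E
    & ((take 2 p.1 == hu) && (take 2 p.2 == hv)) ||
      ((take 2 p.1 == hv) && (take 2 p.2 == hu))].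

Definition swap (p : seq V * seq V) := (p.2, p.1).

(* Adding the missing edge to X closes a cycle at w, from which the other edge
   of X at w is removed; when X misses w, the missing edge slides along Y and
   the two paths exchange roles so that this is still an involution. *)
Definition rotation (p : seq V * seq V) :=
  let: (X, Y) := p in
  let w := last u Y in
  if w \notin X then (take (size Y).-1 Y, rcons X w) else
  if w == head u X then p else
  let i := (index w X).+1 in (take i X ++ rev (drop i X), Y).

Lemma swapK : involutive swap. Proof. by case. Qed.

Lemma lollipop_swap p : lollipop p -> lollipop (swap p).
Proof.
case: p => X Y /and4P[uX uY pE h]; apply/and4P; split=> //=; last by rewrite orbC andbC [X in _ || X]andbC.
apply: perm_trans pE; rewrite /= -!cats1 !catA setUC perm_cat2r.
by rewrite perm_catC.
Qed.

Lemma swap_neq p : lollipop p -> swap p != p.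
Proof.
case: p => X Y /and4P[_ _ _ h]; apply: contra uNv => /eqP[YX XY].
have : head u Y = head u X by rewrite YX.
rewrite -[Y](cat_take_drop 2) -[X](cat_take_drop 2).
by case/orP: h => /andP[/eqP -> /eqP ->]; rewrite headu headv => ->.
Qed.

Lemma head_take2 (X : seq V) : take 2 X == hu \/ take 2 X == hv ->
  exists x y s, [/\ X = x :: y :: s, x = head u X & x = u \/ x = v].
Proof.
move=> h; have [x [y [s XE]]] : exists x y s, X = x :: y :: s.
  case: X h => [|x [|y s]]; last by exists x, y, s.
    by move=> [] /eqP /(congr1 size); rewrite ?size_hu ?size_hv.
  by move=> [] /eqP /(congr1 size); rewrite ?size_hu ?size_hv.
exists x, y, s; split=> //; first by rewrite XE.
have -> : x = head u X by rewrite XE.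
rewrite -[X](cat_take_drop 2).
by case: h => /eqP ->; rewrite ?headu ?headv; [left|right].
Qed.

(* The head of each path has degree 3 in E, one edge being its first edge and
   at most one being the missing edge. *)
Lemma lollipop_head X Y : lollipop (X, Y) -> head u Y \in X.
Proof.
move=> /and4P[/= uX uY pE h].
have h2 : take 2 Y == hu \/ take 2 Y == hv by case/orP: h => /andP[_ ->]; [right|left].
have [x [y [s [YE xE xuv]]]] := head_take2 h2.
rewrite -xE; have deg : count (fun e : {set V} => x \in e) E = 3 by case: xuv => ->.
move: deg; rewrite -(permP pE) count_cat -cats1 count_cat.
move: uY; rewrite YE => uY; rewrite (count_head_pedges uY) /=.
case: (x \in _) => /=; rewrite ?addn0 => deg.
  have : has (fun e : {set V} => x \in e) (pedges X) by rewrite has_count; lia.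
  by case/hasP => e eX xe; apply: mem_pedges xe.
have : has (fun e : {set V} => x \in e) (pedges X) by rewrite has_count; lia.
by case/hasP => e eX xe; apply: mem_pedges xe.
Qed.

Lemma lollipop_rotation p : lollipop p ->
  lollipop (rotation p) /\ rotation (rotation p) = p.
Proof.
case: p => X Y LXY; rewrite /rotation; set w := last u Y.
have /and4P[/= uX uY pE h] := LXY.
have h2 : take 2 Y == hu \/ take 2 Y == hv by case/orP: h => /andP[_ ->]; [right|left].
have h1 : take 2 X == hu \/ take 2 X == hv by case/orP: h => /andP[-> _]; [left|right].
have [x1 [x2 [X' [XE x1E _]]]] := head_take2 h1.
have [y1 [y2 [Y' [YE y1E _]]]] := head_take2 h2.
have x1y1 : x1 != y1.
  rewrite x1E y1E -[X](cat_take_drop 2) -[Y](cat_take_drop 2).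
  by case/orP: h => /andP[/eqP -> /eqP ->]; rewrite headu headv // eq_sym.
case: ifPn => [wX|].
  have YE2 : Y = rcons (take (size Y).-1 Y) w.
    rewrite /w; have : Y != [::] by rewrite YE.
    case/lastP: (Y) => // s z _.
    by rewrite last_rcons size_rcons -cats1 take_size_cat ?cats1.
  set Y1 := take _ _ in YE2 *.
  have wY1 : w \notin Y1 by move: uY; rewrite {1}YE2 rcons_uniq => /andP[].
  have x1Y : x1 \in Y.
    by have := lollipop_head (lollipop_swap LXY); rewrite /= -x1E.
  have x1w : x1 != w by apply: contraNneq wX => <-; rewrite XE mem_head.
  (* Dropping [w] must not destroy the prescribed first edge of [Y]: otherwise [Y] would be
     [[:: y1; w]], and its vertex [x1], different from [w], would be [y1]. *)
  have sY1 : 1 < size Y1.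
    rewrite ltnNge; apply/negP => sY1; have := YE2; have := x1Y; rewrite {1}YE2 YE.
    case: (Y1) sY1 => [|z [|//]] _; rewrite /= !inE ?(negPf x1w) ?orbF; first by [].
    by move=> /eqP <- [x1y1']; rewrite x1y1' eqxx in x1y1.
  have sX : 1 < size X by rewrite XE.
  have tY : take 2 Y1 = take 2 Y by rewrite YE2 -cats1 takel_cat.
  have tX : take 2 (rcons X w) = take 2 X by rewrite -cats1 takel_cat.
  split.
    apply/and4P; split=> /=.
    - by rewrite /Y1 take_uniq.
    - by rewrite rcons_uniq wX.
    - apply: perm_trans pE.
      have Xn : X != [::] by rewrite XE.
      have Y1n : Y1 != [::] by case: (Y1) sY1.
      rewrite (pedges_rcons u _ Xn) last_rcons -/w.
      have -> : pedges Y = rcons (pedges Y1) [set last u Y1; w].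
        by rewrite {1}YE2 (pedges_rcons u _ Y1n).
      rewrite -!cats1 -!catA perm_catCA perm_cat2l perm_cat2l /=.
      by rewrite (perm_catC [:: _] [:: _]).
    - by rewrite tY tX orbC andbC [X in _ || X]andbC.
  rewrite last_rcons wY1; congr (_, _) => //.
  by rewrite size_rcons /= -cats1 take_size_cat.
move=> /negPn wX; case: eqVneq => [wh|wNh].
  by split=> //; rewrite -/w wX /= wh eqxx.
(* [w] is not the head of [X], so the kept prefix contains the first two vertices. *)
have i_gt0 : 0 < index w X.
  by move: wNh wX; rewrite XE /= eq_sym => /negPf ->.
set i := (index w X).+1.
have i_le : i <= size X by rewrite index_mem.
have XE2 : take i X = rcons (take (index w X) X) w.
  by rewrite /i (take_nth u) ?index_mem // nth_index.
have XE3 := cat_take_drop i X; rewrite XE2 in XE3 *.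
have sX1 : size (take (index w X) X) = index w X by rewrite size_takel // ltnW.
move: (take _ _) (drop _ _) sX1 XE3 {XE2} => X1 X2 sX1 /esym XE3.
have wX1 : w \notin X1.
  by move: uX; rewrite XE3 cat_uniq rcons_uniq => /andP[/andP[]].
(* If [w] ended [X], the missing edge would be a loop. *)
have X2n : X2 != [::].
  apply/eqP => X20; have := perm_mem pE [set w; w].
  rewrite (negPf (loopless w)) mem_cat mem_rcons inE {2}XE3 X20 cats0 last_rcons.
  by rewrite eqxx orbT.
have X1n : 0 < size X1 by rewrite sX1.
split.
  apply/and4P; split=> //=.
  - move: uX; rewrite XE3 !cat_uniq rev_uniq => /and3P[-> h3 ->]; rewrite andbT.
    by apply: contra h3 => /hasP[z]; rewrite mem_rev => ? ?; apply/hasP; exists z.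
  - apply: perm_trans pE.
    rewrite XE3 !cat_rcons !pedges_cat -!catA perm_cat2l !last_cat.
    case: X2 X2n {XE3} => // y X2 _.
    rewrite rev_cons /= last_rcons.
    have -> : pedges (w :: rcons (rev X2) y) = rev (pedges (rcons (y :: X2) w)).
      by rewrite -pedges_rev rev_rcons rev_cons.
    rewrite (pedges_rcons y) // rev_rcons -/w (setUC [set w]); apply/permP => q.
    by rewrite -!cats1 /= !count_cat /= ?count_cat count_rev /=; lia.
  - have -> : take 2 (rcons X1 w ++ rev X2) = take 2 X.
      by rewrite XE3 !takel_cat ?size_rcons.
    by [].
have iE : index w (rcons X1 w ++ rev X2) = size X1.
  by rewrite cat_rcons index_cat (negPf wX1) /= eqxx addn0.
rewrite -/w mem_cat mem_rcons inE eqxx /=.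
have -> : head u (rcons X1 w ++ rev X2) = head u X.
  by rewrite XE3; case: (X1) X1n.
rewrite (negPf wNh) iE; congr (_, _).
rewrite -(size_rcons X1 w) take_size_cat // drop_size_cat // revK.
by rewrite -XE3.
Qed.

Lemma second_lollipop p : lollipop p -> rotation p = p ->
  exists q, [/\ lollipop q, rotation q = q & q != p].
Proof.
(* Duplicate-free sequences have at most [#|V|] entries, so all lollipops occur in a finite list. *)
move=> pL pE; pose A := [seq val s | s <- enum {: #|V|.-bseq V}].
have inA (s : seq V) : uniq s -> s \in A.
  move=> us; have sz : size s <= #|V| by rewrite -(card_uniqP us) max_card.
  by apply/mapP; exists (Bseq sz); rewrite ?mem_enum.
have uA : uniq A by rewrite map_inj_uniq ?enum_uniq //; apply: val_inj.
pose L := [seq q <- [seq (X, Y) | X <- A, Y <- A] | lollipop q].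
have memL q : (q \in L) = lollipop q.
  rewrite mem_filter; case: (boolP (lollipop q)) => // qL.
  case: q qL => X Y /and4P[/= /inA XA /inA YA _ _]; apply/allpairsP.
  by exists (X, Y).
have uL : uniq L.
  by apply: filter_uniq; apply: allpairs_uniq => // -[? ?] [? ?].
have [|||q [qL qE qp]] := @second_fixpoint _ L rotation swap p uL _ _ _ pE.
- by move=> q; rewrite !memL; apply: lollipop_rotation.
- by move=> q; rewrite !memL => qL; split; [apply: lollipop_swap|apply: swapK|apply: swap_neq].
- by rewrite memL.
by exists q; rewrite -memL.
Qed.

End Lollipop.

(** * A second decomposition of two edge-disjoint cycles *)

Section SecondCycle.
Variable V : finType.
Implicit Types (x y z : V) (s t l r : seq V).

Lemma deg_head_pedges x s : uniq (x :: s) -> s != [::] ->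
  count (fun e : {set V} => x \in e) (pedges (x :: s)) = 1.
Proof. by case: s => // y s us _; apply: count_head_pedges. Qed.

Lemma deg_head_cedges x s : uniq (x :: s) -> s != [::] ->
  count (fun e : {set V} => x \in e) (cedges (x :: s)) = 2.
Proof.
by move=> us sn; rewrite cedgesE -cats1 count_cat deg_head_pedges //= !inE eqxx orbT.
Qed.

Lemma loopless_pedges x s : uniq s -> [set x; x] \notin pedges s.
Proof.
move=> us; apply/pedgesP => -[l [a [b [r [sE]]]]]; rewrite setUid => /setP E.
have := E a; have := E b; rewrite !inE !eqxx orbT /= => /eqP bx /eqP ax.
by move: us; rewrite sE ax bx cat_uniq /= mem_head !andbF.
Qed.

Lemma loopless_cedges y x s : uniq (x :: s) -> s != [::] -> [set y; y] \notin cedges (x :: s).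
Proof.
move=> us sn; rewrite cedgesE mem_rcons inE negb_or loopless_pedges // andbT.
case/lastP: s us sn => // s z us _; rewrite last_rcons setUid; apply/eqP => /setP E.
have := E x; have := E z; rewrite !inE !eqxx orbT /= => /eqP zy /eqP xy.
by move: us; rewrite xy -zy /= mem_rcons mem_head.
Qed.

Lemma cedges_mem s e x : e \in cedges s -> x \in e -> x \in s.
Proof.
case: s => // y s; rewrite cedgesE mem_rcons inE => /predU1P[->|]; last exact: mem_pedges.
by rewrite !inE => /orP[]/eqP ->; rewrite ?eqxx // -in_cons mem_last.
Qed.

(* Closing up the paths of another fixed point of the rotation, with the
   segment of the first cycle from v back to u, decomposes the same edges into
   two other cycles; the longer of them mixes the two given cycles. *)
Lemma mixed_cycle u v a1 a2 b1 b2 m :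
  let A := u :: a1 ++ v :: a2 in let B := u :: b1 ++ v :: b2 in
  uniq A -> uniq B -> uniq (cedges A ++ cedges B) ->
  size A = m -> size B = m -> {in a2, forall x, x \notin b1 ++ b2} ->
  exists t, [/\ uniq (u :: t), m <= (size t).+1,
    {subset cedges (u :: t) <= cedges A ++ cedges B},
    ~ {subset cedges (u :: t) <= cedges A} &
    ~ {subset cedges (u :: t) <= cedges B}].
Proof.
move=> A B uA uB uAB sA sB a2B.
(* [D] is the segment of [A] set aside. [X0] is [B] cut open at [v], so that [(X0, Y0)] is a fixed
   point of the rotation: [Y0] ends at the head of [X0]. *)
pose D := pedges (v :: rcons a2 u).
pose Y0 := u :: rcons a1 v; pose X0 := v :: b2 ++ u :: b1.
have AE : cedges A = pedges Y0 ++ D.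
  by rewrite /cedges /A -cat_cons rcons_cat rcons_cons pedges_cat.
have BE : perm_eq (cedges X0) (cedges B) by rewrite perm_sym cedges_rot.
pose E0 := pedges Y0 ++ cedges B.
have uY0 : uniq Y0.
  by move: uA; rewrite /A -cat_rcons -cat_cons cat_uniq => /andP[].
have uX0 : uniq X0.
  rewrite (@perm_uniq _ _ B) //; apply/permP => q.
  by rewrite /= !count_cat /=; clear; lia.
have uNv : u != v.
  by move: uY0; rewrite /Y0 /= mem_rcons inE negb_or => /andP[/andP[]].
have b1n : b1 ++ v :: b2 != [::] by case: (b1).
have b2n : b2 ++ u :: b1 != [::] by case: (b2).
have a1n : rcons a1 v != [::] by case: (a1).
have degu : count (fun e : {set V} => u \in e) E0 = 3.
  by rewrite count_cat deg_head_pedges ?deg_head_cedges.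
have degv : count (fun e : {set V} => v \in e) E0 = 3.
  rewrite count_cat -(permP BE) deg_head_cedges //.
  rewrite -count_rev -pedges_rev /Y0 -rcons_cons rev_rcons deg_head_pedges //.
    by rewrite -rev_rcons rev_uniq.
  by rewrite rev_cons; case: (rev a1).
have ll x : [set x; x] \notin E0.
  by rewrite mem_cat negb_or loopless_pedges ?loopless_cedges.
have mE0 e x : e \in E0 -> x \in e -> x \notin a2.
  rewrite mem_cat => /orP[/mem_pedges h /h|/cedges_mem h /h].
    move: uA; rewrite /A -cat_rcons -cat_cons cat_uniq => /and3P[_ /hasPn h' _] xY.
    by apply: contraL xY => /h'.
  rewrite inE mem_cat inE => xB; apply/negP => xa2.
  have := a2B _ xa2; rewrite mem_cat negb_or => /andP[xb1 xb2].
  move: xB; rewrite (negPf xb1) (negPf xb2) !orbF => /orP[]/eqP xE; subst x.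
    by move: uA; rewrite /A /= mem_cat inE xa2 !orbT.
  by move: uA; rewrite /A /= cat_uniq /= xa2 /= !andbF.
have sY0 : size (take 2 Y0) = 2 by rewrite size_takel //= size_rcons.
have sX0 : size (take 2 X0) = 2 by rewrite size_takel //= size_cat /= addnS.
have [||||||[X Y] [qL qE qp]] := @second_lollipop V u v (take 2 Y0) (take 2 X0) E0 uNv _ _ _ _ degu degv ll (X0, Y0).
- by [].
- by [].
- exact: sY0.
- exact: sX0.
- apply/and4P; split=> //=; last by rewrite !eqxx orbT.
  apply/permP => q; rewrite /E0 !count_cat -(permP BE) /X0 cedgesE last_rcons.
  by rewrite -!cats1 !count_cat !last_cat /=; clear; lia.
- by rewrite /= last_rcons /X0 /= mem_head eqxx.
have /and4P[uX uY pE h] := qL; rewrite /= in uX uY pE h.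
have uE0 : uniq E0.
  move: uAB; rewrite AE /E0 -catA !cat_uniq.
  move=> /and3P[-> h1 /and3P[_ _ ->]]; rewrite andbT.
  by apply: contra h1 => /hasP[e eB eY]; apply/hasP; exists e; rewrite ?mem_cat ?eB ?orbT.
have [X1 [x [y XE]]] : exists X1 x y, X = x :: y :: X1.
  have : size (take 2 X) = 2 by case/orP: h => /andP[/eqP -> _].
  by case: (X) => [|x [|y X1]] // _; exists X1, x, y.
have hXY : head u X != head u Y.
  rewrite -[X](cat_take_drop 2) -[Y](cat_take_drop 2).
  by case/orP: h => /andP[/eqP -> /eqP ->] //=; rewrite eq_sym.
(* Otherwise either [Y] would be [rcons X w], with the same head as [X], or the part of [X] after
   [w] would be its own reversal: if empty this gives a loop, with one vertex a repeated edge of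
   [E0], with more a repeated vertex. *)
have lY : last u Y = head u X.
  move: qE; rewrite /=; set w := last u Y; case: ifPn => [wX [_ YX]|/negPn wX].
    by move: hXY; rewrite -YX XE /= eqxx.
  case: eqVneq => // _ [] XX.
  have /eqP : take (index w X).+1 X ++ drop (index w X).+1 X =
              take (index w X).+1 X ++ rev (drop (index w X).+1 X).
    by rewrite XX cat_take_drop.
  rewrite eqseq_cat // eqxx /= => /eqP.
  have XE2 : X = take (index w X) X ++ w :: drop (index w X).+1 X.
    have XE3 : take (index w X).+1 X = rcons (take (index w X) X) w.
      by rewrite (take_nth u) ?index_mem // nth_index.
    by rewrite -cat_rcons -XE3 cat_take_drop.
  move: (take _ _) (drop _ _) XE2 => X2 X3 XE2.
  have lX : last u X = last w X3 by rewrite XE2 last_cat.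
  case: X3 XE2 lX => [|z [|z' X3]] XE2 /= lX.
  - have := perm_mem pE [set w; w]; rewrite (negPf (ll w)) mem_cat mem_rcons inE.
    by rewrite lX eqxx orbT.
  - have := perm_uniq pE; rewrite uE0 cat_uniq rcons_uniq => /and3P[_ + _].
    move=> /hasPn /(_ [set last u X; w]); rewrite mem_rcons mem_head => /(_ isT).
    by rewrite /= lX XE2 pedges_cat mem_cat negb_or setUC mem_head andbF.
  - rewrite [rev (z :: _)]rev_cons; case rE: (rev (z' :: X3)) => [|y' t].
      by have := size_rev (z' :: X3); rewrite rE.
    case=> zy _; have : uniq (z :: z' :: X3) by move: uX; rewrite XE2 cat_uniq => /and3P[_ _ /andP[]].
    by rewrite cons_uniq -(mem_rev (z' :: X3)) rE zy mem_head.
have cXE : cedges X = rcons (pedges X) [set last u X; last u Y].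
  by rewrite lY {1}XE cedgesE XE.
have take2 (z z' : V) (s t : seq V) :
    take 2 (z :: z' :: s) == take 2 t -> exists t', t = z :: z' :: t'.
  case: t => [|c [|c' t]]; rewrite /= ?take0 => /eqP //.
  by case=> -> ->; exists t.
have dAB f : f \in cedges A -> f \notin cedges B.
  by move: uAB; rewrite cat_uniq => /and3P[_ /hasPn dAB _]; apply: contraL => /dAB.
have hd Z z s : take 2 Z == take 2 (z :: s) -> exists t, Z = z :: t.
  by case: Z => // z' Z /eqP [->]; exists Z.
have uNX : u \in X.
  case/orP: h => /andP[hX hY]; first by have [t ->] := hd _ _ _ hX; apply: mem_head.
  have := @lollipop_head V u v (take 2 Y0) (take 2 X0) E0 uNv (fun _ => erefl) (fun _ => erefl) sY0 sX0 degu degv X Y qL.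
  by have [t ->] := hd _ _ _ hY.
(* Here the prescribed first edges are used. If [X] starts like [Y0], its cycle has an edge of [A]
   and cannot be [B]; if it starts like [X0] and closes up to [B], both paths are forced. [Y1] is
   [Y] oriented from [u] to [v]. *)
have [W [Y1 [uY1 Y1E pY1 hX]]] : exists W Y1, [/\ uniq Y1, Y1 = u :: rcons W v,
    perm_eq (pedges Y1) (pedges Y) &
    perm_eq (cedges X) (cedges B) -> (X, Y) = (X0, Y0)].
  have [y1 [W YE]] : exists y t, Y = rcons (y :: t) (head u X).
    have : size (take 2 Y) = 2 by case/orP: h => /andP[_ /eqP ->].
    rewrite -lY; case/lastP: (Y) => [|[|y' t] z] // _; exists y', t.
    by rewrite last_rcons.
  case/orP: h => /andP[hX hY].
    exists (rev W), (rev Y); rewrite rev_uniq uY pedges_rev perm_rev; split=> //.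
      have [t XE2] := hd _ _ _ hX; have [t' YE2] := hd _ _ _ hY.
      by move: YE2; rewrite YE XE2 => -[-> _]; rewrite rev_rcons rev_cons.
    move=> /perm_mem /(_ [set x; y]); rewrite XE /cedges rcons_cons pedges_cons2 mem_head.
    move: hX; rewrite XE => /(take2 _ _ _ Y0)[t Y0E] /esym; apply: contraTeq => _.
    by apply: dAB; rewrite AE mem_cat Y0E pedges_cons2 mem_head.
  exists W, Y; split=> //.
    have [t XE2] := hd _ _ _ hX; have [t' YE2] := hd _ _ _ hY.
    by move: YE2; rewrite YE XE2 => -[-> _].
  move=> pXB; have pY : perm_eq (pedges Y) (pedges Y0).
    apply/permP => q; have := permP pE q; have := permP pXB q.
    by rewrite cXE /E0 -!cats1 !count_cat /=; clear; lia.
  congr pair.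
    move: hX pXB uX uX0; rewrite -(permPr BE) XE => /(take2 _ _ _ X0)[t ->].
    by move=> pXX0 uX uX'; rewrite (cedges_inj uX uX' pXX0).
  have [t YE2] := hd _ _ _ hY; move: pY uY; rewrite YE2 => pY uY'.
  by congr cons; apply: pedges_inj pY.
have pX : perm_eq (cedges X ++ pedges Y1) E0.
  apply: perm_trans pE; apply/permP => q.
  rewrite cXE -!cats1 !count_cat /= (permP pY1) !addn0 -addnA.
  by congr addn; apply: addnC.
have a2Y1 : ~~ has (mem Y1) a2.
  apply/hasPn => z za2; apply/negP => zY1; have [|t _] := mem_pedges_nbr zY1.
    by rewrite Y1E /= size_rcons.
  move=> e1; have := mE0 [set z; t] z; rewrite -(perm_mem pX) mem_cat e1 orbT za2.
  by rewrite !inE eqxx; move/(_ isT isT).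
have uZ2 : uniq (Y1 ++ a2).
  by rewrite cat_uniq uY1 a2Y1 /=; move: uA; rewrite /A -cat_rcons -cat_cons cat_uniq => /and3P[].
have Z2E : cedges (Y1 ++ a2) = pedges Y1 ++ D.
  by rewrite Y1E cat_cons cat_rcons /cedges rcons_cons rcons_cat rcons_cons -cat_cons pedges_cat.
have pZ : perm_eq (cedges X ++ cedges (Y1 ++ a2)) (cedges A ++ cedges B).
  rewrite Z2E AE; apply/permP => q; have := permP pX q.
  by rewrite /E0 !count_cat; clear; lia.
have XB : ~ perm_eq (cedges X) (cedges B).
  by move=> /hX e; rewrite e eqxx in qp.
have [e eZ2 eA] : exists2 e, e \in cedges (Y1 ++ a2) & e \in cedges A.
  have [e eD] : exists e, e \in D.
    by rewrite /D; case: (a2) => [|z a]; eexists; apply: mem_head.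
  by exists e; rewrite ?Z2E ?AE mem_cat eD orbT.
have [X2 [sX2 uX2 pX2]] : exists X1, [/\ size (u :: X1) = size X, uniq (u :: X1) &
   perm_eq (cedges (u :: X1)) (cedges X)].
  case/splitPr: uNX uX => l r uX; exists (r ++ l); split.
  - by rewrite /= !size_cat addnS addnC.
  - rewrite (@perm_uniq _ _ (l ++ u :: r)) //; apply/permP => q.
    by rewrite /= !count_cat /=; clear; lia.
  - by case: (l) => [|z l']; rewrite ?cats0 // cat_cons; apply: cedges_rot.
have szs : size X + size (Y1 ++ a2) = m + m.
  have := perm_size pZ; rewrite [size (cedges X ++ _)]size_cat [RHS]size_cat.
  by rewrite !size_cedges sA sB.
have uZ : uniq (cedges X ++ cedges (Y1 ++ a2)) by rewrite (perm_uniq pZ).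
have := uZ; rewrite cat_uniq => /and3P[ucX /hasPn dXZ ucZ].
(* The longer cycle has at least [m] edges, so inside [A] or [B] it would be all of it, leaving the
   rest to the other cycle; the edge [e] and [XB] exclude this. *)
have [mX|mX] := leqP m (size X).
  exists X2; split=> //.
  - by rewrite -[_.+1]/(size (u :: X2)) sX2.
  - by move=> f; rewrite (perm_mem pX2) -(perm_mem pZ) mem_cat => ->.
  - move=> sub; have [] := @uniq_min_size _ (cedges X) (cedges A) ucX.
    + by move=> f; rewrite -(perm_mem pX2) => /sub.
    + by rewrite !size_cedges sA.
    by move=> _ /(_ e); rewrite eA => eX; have := dXZ _ eZ2; rewrite /= eX.
  - move=> sub; have [] := @uniq_min_size _ (cedges X) (cedges B) ucX.
    + by move=> f; rewrite -(perm_mem pX2) => /sub.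
    + by rewrite !size_cedges sB.
    move=> _ XeB; apply: XB; apply: uniq_perm => //.
    by move: uAB; rewrite cat_uniq => /and3P[].
have mZ : m <= size (Y1 ++ a2) by move: mX szs; clear; lia.
have Z2u : Y1 ++ a2 = u :: rcons W v ++ a2 by rewrite Y1E.
exists (rcons W v ++ a2); rewrite -Z2u; split=> //.
- by move: mZ; rewrite Z2u.
- by move=> f fZ; rewrite -(perm_mem pZ) mem_cat fZ orbT.
- move=> sub; have [] := uniq_min_size ucZ sub; first by rewrite !size_cedges sA.
  move=> _ ZeA; apply: XB; apply/permP => q; have := permP pZ q; rewrite !count_cat.
  suff /permP -> : perm_eq (cedges (Y1 ++ a2)) (cedges A) by clear; lia.
  by apply: uniq_perm => //; move: uAB; rewrite cat_uniq => /and3P[].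
by move=> /(_ _ eZ2); apply/negP; apply: dAB.
Qed.
End SecondCycle.

Lemma split_last (T : eqType) (a : pred T) (s : seq T) : has a s ->
  exists l x r, [/\ s = l ++ x :: r, a x & ~~ has a r].
Proof.
elim: s => // x s IH; case: (boolP (has a s)) => [/IH[l [y [r [-> ay ar]]]] _|as_].
  by exists (x :: l), y, r.
by rewrite /= (negPf as_) orbF => ax; exists [::], x, s.
Qed.

Lemma uniq_cedges (V : finType) (s : seq V) : uniq s -> 2 < size s -> uniq (cedges s).
Proof.
case: s => [|x [|y [|z s]]] // us _.
rewrite /cedges !rcons_cons pedges_cons2 cons_uniq uniq_pedges; last first.
  by rewrite -!rcons_cons rcons_uniq.
rewrite andbT pedges_cons2 inE negb_or; apply/andP; split.
  rewrite setUC; apply: contraTneq us => /set2_inj ->.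
  by rewrite /= !inE eqxx orbT.
apply/negP => /(@mem_pedges _ _ _ y); rewrite !inE eqxx orbT mem_rcons inE => /(_ isT) yE.
move: us yE; rewrite /= !inE !negb_or eq_sym => /and3P[/and3P[/negPf -> _ _]].
by move=> /andP[/negPf -> /negPf ->].
Qed.

(** * A long path using edges of two intersecting paths *)

Section MixedPath.
Variable V : finType.
Implicit Types (x y : V) (s t z l r : seq V) (e : {set V}).

Definition mixes s t := exists z, [/\ uniq z, size s <= size z,
  {subset pedges z <= pedges s ++ pedges t},
  has (mem (pedges s)) (pedges z) & has (mem (pedges t)) (pedges z)].

Lemma mixes_sym s t : size s = size t -> mixes s t -> mixes t s.
Proof.
move=> st [z [uz sz sub h1 h2]]; exists z; split; rewrite -?st //.
by move=> e /sub; rewrite !mem_cat orbC.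
Qed.

Lemma mixes_rev s t : mixes (rev s) t -> mixes s t.
Proof.
move=> [z [uz sz sub h1 h2]]; exists z; split=> //; first by rewrite -size_rev.
  by move=> e /sub; rewrite !mem_cat pedges_rev mem_rev.
by move: h1; rewrite pedges_rev; congr (is_true _); apply: eq_has => e; rewrite /= mem_rev.
Qed.

(** Rotation at an end: an edge [xw] of [t] at the head either extends the path or, when [w] is on
    it, replaces the edge entering [w]. No vertex is lost, and the first edge survives because [xw]
    is not an edge of the path. *)
Lemma mixes_head x s t : uniq (x :: s) -> uniq t -> s != [::] -> 1 < size t ->
  ~~ has (mem (pedges (x :: s))) (pedges t) -> x \in t -> mixes (x :: s) t.
Proof.
move=> us ut sn t_gt1 /hasPn dst xt; have [w wt xw] := mem_pedges_nbr xt t_gt1.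
have [ws|wNs] := boolP (w \in x :: s); last first.
  exists (w :: x :: s); split=> //; first by rewrite cons_uniq wNs.
  - by move=> e; rewrite pedges_cons2 inE mem_cat => /predU1P[->|->//]; rewrite setUC xw orbT.
  - case: (s) sn => // y r _; apply/hasP; exists [set x; y].
      by rewrite !pedges_cons2 !inE eqxx orbT.
    by rewrite /= pedges_cons2 mem_head.
  - by apply/hasP; exists [set x; w] => //; rewrite pedges_cons2 setUC mem_head.
have xNw : w != x by apply: contraNneq (loopless_pedges x ut) => wx; rewrite -{2}wx.
move: ws; rewrite inE (negPf xNw) /= => /splitPr ws; case: ws us sn dst => l r us sn dst.
case/lastP: l us sn dst => [|l y] us sn dst.
  by have := dst _ xw; rewrite /= pedges_cons2 mem_head.
exists (rev (x :: rcons l y) ++ w :: r); split.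
- rewrite -(@perm_uniq _ (x :: rcons l y ++ w :: r)) //.
  by rewrite -cat_cons perm_cat2r perm_sym perm_rev.
- by rewrite size_cat size_rev -size_cat.
- move=> e; rewrite pedges_cat rev_cons pedges_rcons2 -rev_cons pedges_rev.
  rewrite mem_cat mem_rcons inE mem_rev => h; rewrite mem_cat -cat_cons pedges_cat mem_cat.
  case/orP: h => [/predU1P[->|eP]|->]; rewrite ?xw ?orbT //.
  by rewrite -cats1 pedges_catl.
- apply/hasP; exists [set x; head x (rcons l y)].
    rewrite pedges_catl // pedges_rev mem_rev.
    by case: (l) => *; rewrite /= pedges_cons2 mem_head.
  by case: (l) => *; rewrite /= pedges_cons2 mem_head.
- apply/hasP; exists [set x; w] => //.
  by rewrite rev_cons cat_rcons pedges_catr // pedges_cons2 mem_head.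
Qed.

Lemma pedges_map (W : finType) (f : V -> W) s :
  pedges (map f s) = [seq f @: e | e : {set V} <- pedges s].
Proof.
elim: s => // x [|y s] IH //; rewrite [map f _]/= !pedges_cons2 /= -IH.
by rewrite imsetU !imset_set1.
Qed.

(** Separates, in a path closed up through the extra vertex [None], the two edges at [None], which
    identify the ends of [s], from the edges of [s] itself. *)
Lemma cedges_None s f : f \in cedges (None :: map Some s) -> s != [::] ->
  (exists2 x, f = [set None; Some x] & ((x == head x s) || (x == last x s)) && (x \in s)) \/
  (exists2 e, e \in pedges s & f = Some @: e).
Proof.
case: s => // x s + _; rewrite cedgesE mem_rcons inE [map _ _]/= pedges_cons2 inE.
rewrite -map_cons pedges_map /= last_map; case/or3P => [/eqP->|/eqP->|/mapP[e eP ->]].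
- by left; exists (last x s); rewrite ?(setUC [set None]) //= eqxx orbT mem_last.
- by left; exists x; rewrite //= eqxx mem_head.
- by right; exists e.
Qed.

Lemma Some_imset_inj : injective (fun e : {set V} => Some @: e).
Proof. by apply: imset_inj => x y []. Qed.

Lemma None_notin e : None \notin Some @: e.
Proof. by apply/imsetP => -[]. Qed.

Lemma cedges_None_inner s e : s != [::] ->
  Some @: e \in cedges (None :: map Some s) -> e \in pedges s.
Proof.
move=> sn eE; have [[x xE]|[e' e's /Some_imset_inj -> //]] := cedges_None eE sn.
by have := None_notin e; rewrite xE !inE eqxx.
Qed.

(** Some edge of the closed [z] lies in the closed [t] but not in the closed [s]. If it is not an
    edge of [t], it joins [None] to a common end [x] of [z] and [t]; as [x] is not on [s], the edge
    of [z] at [x] belongs to [t]. *)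
Lemma mixed_side s t z : t != [::] -> 1 < size z ->
  {in t, forall x, (x == head x t) || (x == last x t) -> x \notin s} ->
  {subset pedges z <= pedges s ++ pedges t} ->
  {subset cedges (None :: map Some z) <=
    cedges (None :: map Some s) ++ cedges (None :: map Some t)} ->
  ~ {subset cedges (None :: map Some z) <= cedges (None :: map Some s)} ->
  has (mem (pedges t)) (pedges z).
Proof.
move=> tn z_gt1 tNs zst czst /allP; rewrite -has_predC => /hasP[f fz fNs].
have ft : f \in cedges (None :: map Some t).
  by have := czst f fz; rewrite mem_cat (negPf (fNs : f \notin _)).
have zn : z != [::] by case: (z) z_gt1.
have [[x fx /andP[_ xz]]|[e ez fe]] := cedges_None fz zn; last first.
  by apply/hasP; exists e => //; apply: cedges_None_inner; rewrite -?fe.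
have [[y fy /andP[yht yt]]|[e _ fe]] := cedges_None ft tn; last first.
  by have := None_notin e; rewrite -fe fx !inE eqxx.
have xy : x = y by move: fy; rewrite fx => /set2_inj [].
have [w _ xw] := mem_pedges_nbr xz z_gt1; apply/hasP; exists [set x; w] => //=.
have := zst _ xw; rewrite mem_cat => /orP[xs|//].
have := mem_pedges xs (x := x); rewrite !inE eqxx => /(_ isT).
by rewrite xy (negPf (tNs y yt yht)).
Qed.

(* Joining both ends of both paths to a new vertex None turns them into two
   cycles. *)
Lemma mixed_path s t : uniq s -> uniq t -> 1 < size s -> size s = size t ->
  ~~ has (mem (pedges s)) (pedges t) -> has (mem s) t -> mixes s t.
Proof.
move=> us ut s_gt1 sz dst st.
have t_gt1 : 1 < size t by rewrite -sz.
have dts : ~~ has (mem (pedges t)) (pedges s) by rewrite has_sym.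
(* An end of one path lying on the other settles the claim by [mixes_head]. Afterwards the two paths
   have no common end, which makes the closed-up cycles edge-disjoint at [None] too. *)
have ends (a b : seq V) : uniq a -> uniq b -> 1 < size a -> size a = size b ->
    ~~ has (mem (pedges a)) (pedges b) ->
    mixes a b \/ {in a, forall x, (x == head x a) || (x == last x a) -> x \notin b}.
  move=> ua ub a_gt1 sab dab.
  case: (boolP (has [pred x | ((x == head x a) || (x == last x a)) && (x \in b)] a)); last first.
    by move=> /hasPn h; right=> x xa xh; have := h x xa; rewrite /= xh.
  case/hasP => x xa /andP[/orP[]/eqP xE xb]; left.
    case: a ua a_gt1 sab dab {xa} xE => // y a ua a_gt1 sab dab /= xE; subst y.
    by apply: mixes_head => //; [case: (a) a_gt1|rewrite -sab].
  apply: mixes_rev; case/lastP: a ua a_gt1 sab dab {xa} xE => // a y ua a_gt1 sab dab.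
  rewrite last_rcons => xE; subst y; rewrite rev_rcons.
  apply: mixes_head => //; rewrite -?rev_rcons ?rev_uniq //.
  - by case/lastP: (a) a_gt1 => // ? ?; rewrite rev_rcons.
  - by rewrite -sab.
  - by rewrite pedges_rev; apply: contra dab => /hasP[e eb]; rewrite /= mem_rev => ea; apply/hasP; exists e.
have [//|sNt] := ends s t us ut s_gt1 sz dst.
have [/mixes_sym|tNs] := ends t s ut us t_gt1 (esym sz) dts; first by apply.
(* With [v] the last vertex of [s] on [t], the segment [s2] avoids [t], as [mixed_cycle]
   requires. *)
have /split_last[s1 [v [s2 [sE vt s2t]]]] : has (mem t) s by rewrite has_sym.
have [t1 [t2 tE]] : exists t1 t2, t = t1 ++ v :: t2.
  by case/splitPr: vt => t1 t2; exists t1, t2.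
have sn : s != [::] by case: (s) s_gt1.
have tn : t != [::] by case: (t) t_gt1.
pose A := None :: map Some s; pose B := None :: map Some t.
have AE : A = None :: map Some s1 ++ Some v :: map Some s2 by rewrite /A sE map_cat.
have BE : B = None :: map Some t1 ++ Some v :: map Some t2 by rewrite /B tE map_cat.
have uNS (r : seq V) : uniq r -> uniq (None :: map Some r).
  move=> ur; rewrite /= map_inj_uniq ?ur ?andbT; last by move=> ? ? [].
  by apply/mapP => -[].
have uAB : uniq (cedges A ++ cedges B).
  rewrite cat_uniq !uniq_cedges ?uNS //= ?size_map // andbT.
  apply/hasPn => f fB; apply/negP => fA.
  have [[x fx /andP[xhs xs]]|[e es fe]] := cedges_None fA sn.
    have [[y fy /andP[yht yt]]|[e _ fe]] := cedges_None fB tn.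
      have xy : x = y by move: fy; rewrite fx => /set2_inj [].
      by have := sNt x xs xhs; rewrite xy yt.
    by have := None_notin e; rewrite -fe fx !inE eqxx.
  move: fB; rewrite fe => /cedges_None_inner -/(_ tn) et.
  by move/hasP: dst; case; exists e.
have := @mixed_cycle _ None (Some v) (map Some s1) (map Some s2) (map Some t1) (map Some t2) (size s).+1.
rewrite -AE -BE => -[].
- exact: uNS.
- exact: uNS.
- exact: uAB.
- by rewrite /= size_map.
- by rewrite /= size_map sz.
- move=> _ /mapP[x xs2 ->]; rewrite -map_cat mem_map; last by move=> ? ? [].
  have := hasPn s2t x xs2; rewrite /= tE !mem_cat inE !negb_or.
  by case/and3P => -> _ ->.
move=> c [uc c_size cAB cA cB].
have [z cE] : exists z, c = map Some z.
  exists (pmap id c); elim: c uc {c_size cAB cA cB} => // -[x|] c IH; last by case/andP; rewrite mem_head.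
  rewrite /= !inE /= => /andP[h1 /andP[_ h2]].
  by congr cons; apply: IH; rewrite /= h1.
subst c; have z_size : size s <= size z by rewrite size_map in c_size.
have zst : {subset pedges z <= pedges s ++ pedges t}.
  move=> e ez; have /cAB : Some @: e \in cedges (None :: map Some z).
    rewrite cedgesE mem_rcons inE; apply/orP; right.
    rewrite -cat1s pedges_catr // pedges_map map_f //.
  by rewrite !mem_cat => /orP[]/cedges_None_inner ->; rewrite ?orbT.
have z_gt1 : 1 < size z by apply: leq_trans z_size.
exists z; split=> //.
- by move: uc; rewrite cons_uniq => /andP[_]; rewrite (map_inj_uniq (f := Some)) // => ? ? [].
- apply: (@mixed_side t s z) => //.
  + by move=> e /zst; rewrite !mem_cat orbC.
  + by move=> f /cAB; rewrite !mem_cat orbC.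
- exact: (@mixed_side s t z).
Qed.
End MixedPath.

(** * Connectivity of the H-line graph *)

Lemma isomorphic_sym (G K : sgraph) : isomorphic G K -> isomorphic K G.
Proof.
move=> /isomorphicP[f [g fK gK] fE]; apply/isomorphicP; exists g; first by exists f.
by move=> x y; rewrite -fE !gK.
Qed.

Lemma isomorphic_trans (G K L : sgraph) :
  isomorphic G K -> isomorphic K L -> isomorphic G L.
Proof.
move=> /isomorphicP[f fb fE] /isomorphicP[g gb gE]; apply/isomorphicP.
by exists (g \o f); [apply: bij_comp|move=> x y; rewrite /= gE fE].
Qed.

Lemma set2_eq (T : finType) (x y a b : T) : [set x; y] = [set a; b] ->
  (x = a /\ y = b) \/ (x = b /\ y = a).
Proof.
move=> E; have : x \in [set a; b] by rewrite -E !inE eqxx.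
rewrite !inE => /orP[/eqP xa|/eqP xb].
  by left; split=> //; apply: (@set2_inj _ a); rewrite -{1}xa.
by right; split=> //; apply: (@set2_inj _ b); rewrite -{1}xb E setUC.
Qed.

Lemma pedges_nth (T : finType) (x0 : T) s i j : uniq s -> i < size s -> j < size s ->
  ([set nth x0 s i; nth x0 s j] \in pedges s) = (i.+1 == j) || (j.+1 == i).
Proof.
move=> us; wlog suff imp : i j / i.+1 < size s -> [set nth x0 s i; nth x0 s i.+1] \in pedges s.
  move=> si sj; apply/idP/idP; last first.
    by move=> /orP[]/eqP jE; move: si sj; rewrite -jE ?(setUC [set nth _ _ _.+1]) => *; apply: imp.
  case/pedgesP => l [x [y [r [sE e]]]].
  have ix : index x s = size l.
    move: us; rewrite sE cat_uniq index_cat /= => /and3P[_ + _].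
    by rewrite negb_or => /andP[/negPf -> _]; rewrite eqxx addn0.
  have iy : index y s = (size l).+1.
    move: us; rewrite sE -cat_rcons cat_uniq index_cat => /and3P[_ + _].
    by rewrite /= negb_or => /andP[/negPf -> _]; rewrite eqxx addn0 size_rcons.
  have := index_uniq x0 si us; have := index_uniq x0 sj us.
  case: (set2_eq e) => -[-> ->]; rewrite ix iy => <- <-; rewrite eqxx ?orbT //.
move=> si; apply/pedgesP; exists (take i s), (nth x0 s i), (nth x0 s i.+1), (drop i.+2 s).
by split=> //; rewrite -!drop_nth ?cat_take_drop // ltnW.
Qed.

(** Adjacency needs a path on exactly [n] vertices; this cuts one out of a longer path around the
    factor [m], taking as much as possible from the left and the rest from the right. *)
Lemma window (T : Type) n (l m r : seq T) : size m <= n <= size (l ++ m ++ r) ->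
  exists l1 l2 r1 r2, [/\ l = l1 ++ l2, r = r1 ++ r2 & size (l2 ++ m ++ r1) = n].
Proof.
rewrite !size_cat => /andP[mn nl].
pose i := minn (size l) (n - size m).
exists (take (size l - i) l), (drop (size l - i) l),
  (take (n - size m - i) r), (drop (n - size m - i) r).
rewrite !cat_take_drop !size_cat size_drop size_take; split=> //.
by rewrite /i; case: ifP; lia.
Qed.

Lemma sorted_connect (T : finType) (r : rel T) (s : seq T) : symmetric r -> sorted r s ->
  {in s &, forall x y, connect r x y}.
Proof.
move=> /sym_connect_sym rsym; case: s => // x0 s /path_connect rs x y xs ys.
by apply: connect_trans (rs y ys); rewrite rsym; apply: rs.
Qed.

(** The longer of the two arms at [x] will do. Having more than half of the vertices makes two such
    halves, of disjoint [n]-vertex paths, add up to at least [n]. *)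
Lemma half_path (T : finType) (x : T) s : uniq s -> x \in s -> exists h,
  [/\ uniq (x :: h), size s < (size (x :: h)).*2,
      {subset pedges (x :: h) <= pedges s} & {subset x :: h <= s}].
Proof.
move=> us /splitPr xs; case: xs us => l r us.
have [lr|rl] := leqP (size l) (size r).
  exists r; split.
  - by move: us; rewrite cat_uniq => /and3P[].
  - by rewrite size_cat -addnn ltn_add2r ltnS.
  - exact: pedges_catr.
  - by move=> y; rewrite mem_cat => ->; rewrite orbT.
exists (rev l); rewrite -rev_rcons; split.
- by move: us; rewrite -cat_rcons cat_uniq rev_uniq => /and3P[].
- by rewrite size_rev size_cat size_rcons -addnn [X in _ < X]addSnnS ltn_add2l ltnS ltnW.
- by move=> e; rewrite pedges_rev mem_rev -cat_rcons => /pedges_catl; apply.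
- by move=> y; rewrite mem_rev -cat_rcons mem_cat => ->.
Qed.

Lemma split_first (T : eqType) (a : pred T) (s : seq T) : has a s ->
  exists l x r, [/\ s = l ++ x :: r, a x & ~~ has a l].
Proof.
rewrite -has_rev => /split_last[l [x [r [sE ax ar]]]].
exists (rev r), x, (rev l); rewrite has_rev; split=> //.
by rewrite -(revK s) sE rev_cat rev_cons cat_rcons.
Qed.

Section Graph.
Variable G : sgraph.
Implicit Types (x y z : G) (s t : seq G) (e f : {set G}).

Lemma mem_edges x y : ([set x; y] \in edges G) = sedge x y.
Proof.
apply/imsetP/idP => [[[a b]]|xy]; last by exists (x, y); rewrite ?inE.
by rewrite inE /= => ab /set2_eq[[-> ->]|[-> ->]] //; rewrite sedge_sym.
Qed.

Lemma sorted_pedges s : reflect {subset pedges s <= edges G} (sorted sedge s).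
Proof.
apply: (iffP idP).
  move=> ss e /pedgesP[l [x [y [r [sE ->]]]]]; rewrite mem_edges.
  by move: ss; rewrite sE sorted_cat_cons => /andP[_ /= /andP[]].
elim: s => // x [|y s] IH // sub.
have xy : sedge x y by rewrite -mem_edges; apply: sub; rewrite pedges_cons2 mem_head.
change (sedge x y && sorted sedge (y :: s)); rewrite xy; apply: IH => e es.
by apply: sub; rewrite pedges_cons2 inE es orbT.
Qed.

Definition gpath s := uniq s && sorted sedge s.

Lemma sorted_pedges_triples (r : rel {set G}) s :
  (forall l x y z t, s = l ++ x :: y :: z :: t -> r [set x; y] [set y; z]) ->
  sorted r (pedges s).
Proof.
elim: s => // x [|y [|z s]] IH // trip.
rewrite !pedges_cons2 [sorted _ _]/= (trip [::] x y z s) //=.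
by apply: IH => l x' y' z' t sE; apply: (trip (x :: l) _ _ _ t); rewrite sE.
Qed.

End Graph.

Section HAdjacency.
Variables (n : nat) (H G : sgraph).
Hypothesis H_path : isomorphic H (path_graph n).
Hypothesis n_gt2 : 2 < n.
Implicit Types (x y z : G) (s t : seq G) (e f : {set G}).

Lemma H_adjacent_sym : symmetric (@H_adjacent H G).
Proof.
move=> e f; rewrite /H_adjacent eq_sym setIC.
by congr [&& _, _ & _]; apply: eq_existsb => S; rewrite [X in _ && X]andbC.
Qed.

Lemma H_adjacent_edges e f : H_adjacent H e f -> f \in edges G.
Proof.
case/and3P => _ _ /existsP[S /and3P[_ _ fS]].
by have /andP[/subsetP/(_ f fS)] := valP S.
Qed.

Lemma path_H_adjacent s e f : gpath s -> size s = n ->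
  e \in pedges s -> f \in pedges s -> e != f -> e :&: f != set0 -> H_adjacent H e f.
Proof.
move=> /andP[us ss] sn es fs ef efn; rewrite /H_adjacent ef efn /=.
have Sax : subgraph_axiom ([set x in s], [set e in pedges s]).
  apply/andP; split=> /=.
    by apply/subsetP => g; rewrite inE; apply/(sorted_pedges s).
  apply/forall_inP => g; rewrite inE => gs; apply/subsetP => x xg.
  by rewrite inE; apply: mem_pedges xg.
pose S := Subgraph Sax; apply/existsP; exists S.
rewrite /subE /= !inE es fs !andbT; apply: (@isomorphic_trans _ (path_graph n)); last first.
  exact: isomorphic_sym.
have xV (x : {x : G | x \in subV S}) : val x \in s.
  by have := valP x; rewrite inE.
have ix (x : {x : G | x \in subV S}) : index (val x) s < n by rewrite -sn index_mem.
have x0 : G by case: (s) sn n_gt2 => [<-|].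
have ni (i : 'I_n) : nth x0 s i \in subV S by rewrite inE mem_nth ?sn.
apply/isomorphicP; exists (fun u => Ordinal (ix u)).
  exists (fun k : 'I_n => exist _ (nth x0 s k) (ni k)) => [x|i].
    apply: val_inj; rewrite /= nth_index //; exact: xV.
  by apply: val_inj; rewrite /= index_uniq ?sn.
move=> x y; rewrite /= /path_rel /= -(pedges_nth x0 us) ?sn ?ix //.
by rewrite !nth_index ?xV // /sub_edge /subE inE.
Qed.

Lemma triple_H_adjacent l x y z r : gpath (l ++ x :: y :: z :: r) ->
  n <= size (l ++ x :: y :: z :: r) -> H_adjacent H [set x; y] [set y; z].
Proof.
move=> /andP[us ss]; rewrite size_cat /= => sz.
have [|l1 [l2 [r1 [r2 [lE rE szE]]]]] := @window _ n l [:: x; y; z] r.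
  by rewrite n_gt2 size_cat.
have xyz : uniq [:: x; y; z].
  move: us; rewrite cat_uniq => /and3P[_ _].
  by rewrite -[_ :: _]/([:: x; y; z] ++ r) cat_uniq => /and3P[].
apply: (@path_H_adjacent (l2 ++ x :: y :: z :: r1)).
- have sE : l ++ x :: y :: z :: r = l1 ++ (l2 ++ x :: y :: z :: r1) ++ r2.
    by rewrite lE rE -!catA.
  apply/andP; split.
    by move: us; rewrite sE !cat_uniq => /and3P[_ _ /andP[]].
  apply/sorted_pedges => e es; move: ss => /sorted_pedges; apply.
  by rewrite sE pedges_catr // pedges_catl.
- exact: szE.
- by apply/pedgesP; exists l2, x, y, (z :: r1).
- by apply/pedgesP; exists (rcons l2 x), y, z, r1; rewrite cat_rcons.
- rewrite setUC; apply: contraTneq xyz => /set2_inj ->.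
  by rewrite /= !inE eqxx orbT.
- by apply/set0Pn; exists y; rewrite !inE eqxx orbT.
Qed.

Lemma sorted_H_adjacent s : gpath s -> n <= size s -> sorted (@H_adjacent H G) (pedges s).
Proof.
move=> gs sn; apply: sorted_pedges_triples => l x y z t sE.
by apply: (@triple_H_adjacent l x y z t); rewrite -sE.
Qed.

Lemma long_path_connect s : gpath s -> n <= size s ->
  {in pedges s &, forall e f, connect (@H_adjacent H G) e f}.
Proof.
move=> gs sn; apply: sorted_connect; first exact: H_adjacent_sym.
exact: sorted_H_adjacent.
Qed.

Lemma joined_paths s t e f : gpath s -> size s = n -> gpath t -> size t = n ->
  (exists u, [/\ gpath u, n <= size u, has (mem (pedges s)) (pedges u)
     & has (mem (pedges t)) (pedges u)]) ->
  e \in pedges s -> f \in pedges t -> connect (@H_adjacent H G) e f.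
Proof.
move=> gs sn gt tn [u [gu un /hasP[g gu' gs'] /hasP[h hu ht]]] es ft.
apply: connect_trans (connect_trans (long_path_connect gu un gu' hu) _).
  by apply: (long_path_connect gs); rewrite ?sn.
by apply: (long_path_connect gt); rewrite ?tn.
Qed.

(** By [joined_paths] one long path meeting both edge sets is enough: [s] itself if an edge is
    shared, [mixed_path] if only vertices are, and otherwise two halves linked by part of a
    connecting path. *)
Lemma connected_paths s t x y e f : gpath s -> size s = n -> gpath t -> size t = n ->
  x \in s -> y \in t -> connect sedge x y ->
  e \in pedges s -> f \in pedges t -> connect (@H_adjacent H G) e f.
Proof.
move=> gs sn gt tn xs yt xy; apply: joined_paths => //.
have /andP[us /sorted_pedges ss] := gs; have /andP[ut /sorted_pedges st] := gt.
have [st'|dst] := boolP (has (mem (pedges s)) (pedges t)).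
  exists s; rewrite gs sn leqnn; split=> //; last by rewrite has_sym.
  by case/hasP: st' => g _ gs'; apply/hasP; exists g.
have [ist|] := boolP (has (mem s) t).
  have [||z [uz zn zst zs zt]] := mixed_path us ut _ _ dst ist.
  - by rewrite sn ltnW.
  - by rewrite sn.
  exists z; split; [|by rewrite -sn|exact: zs|exact: zt].
  apply/andP; split=> //.
  by apply/sorted_pedges => k /zst; rewrite mem_cat => /orP[/ss|/st].
move=> /hasPn tNs; have [p xp yp] := connectP xy.
case/shortenP: xp yp => w xw uw _ yw.
(* Between the last vertex [x'] on [s] and the next vertex [y'] on [t] the connecting path avoids
   both, so halves can be attached at [x'] and [y']. *)
have [l [x' [r [wE /= xs' rs]]]] : exists l x' r, [/\ x :: w = l ++ x' :: r, mem s x' & ~~ has (mem s) r].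
  by apply: split_last; rewrite /= xs.
have yr : y \in r.
  have : y \in x' :: r.
    by have := congr1 (last x) wE; rewrite last_cat /= -yw => ->; apply: mem_last.
  rewrite inE => /predU1P[yx|//]; have := tNs y yt.
  by rewrite /= yx xs'.
have [r1 [y' [r2 [rE /= yt' r1t]]]] : exists r1 y' r2, [/\ r = r1 ++ y' :: r2, mem t y' & ~~ has (mem t) r1].
  by apply: split_first; apply/hasP; exists y.
have [h1 [uh1 szh1 sub1 mem1]] := half_path us xs'.
have [h2 [uh2 szh2 sub2 mem2]] := half_path ut yt'.
rewrite sn in szh1; rewrite tn in szh2.
have first_edge z h : n < (size (z :: h)).*2 -> exists g, g \in pedges (z :: h).
  case: h => [|z' h _]; last by exists [set z; z']; rewrite pedges_cons2 mem_head.
  by rewrite ltnNge ltnW.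
have [g gh1] := first_edge _ _ szh1; have [h hh2] := first_edge _ _ szh2.
have uE : rev (x' :: h1) ++ r1 ++ y' :: h2 = rev h1 ++ x' :: (r1 ++ y' :: h2).
  by rewrite rev_cons cat_rcons.
exists (rev (x' :: h1) ++ r1 ++ y' :: h2); split.
- apply/andP; split.
    have ur1 : uniq r1.
      by move: uw; rewrite wE rE cat_uniq => /and3P[_ _ /= /andP[_]]; rewrite cat_uniq => /andP[].
    rewrite cat_uniq rev_uniq uh1 cat_uniq ur1 uh2 !andbT !andTb; apply/andP; split.
      apply/hasPn => z zr; rewrite mem_rev; suff: z \notin s by apply: contra => /mem1.
      move: zr; rewrite mem_cat => /orP[zr1|/mem2]; last exact: tNs.
      by apply: (hasPn rs); rewrite rE mem_cat zr1.
    apply/hasPn => z /mem2 zt; apply: contraL zt; exact: (hasPn r1t).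
  apply/sorted_pedges => k; rewrite uE pedges_cat mem_cat -rev_cons pedges_rev mem_rev.
  case/orP => [/sub1/ss //|]; rewrite -cat_cons pedges_cat mem_cat => /orP[k1|/sub2/st //].
  apply: (sorted_pedges (x :: w) xw).
  have -> : x :: w = l ++ rcons (x' :: r1) y' ++ r2 by rewrite wE rE cat_rcons.
  by rewrite pedges_catr // pedges_catl.
- rewrite size_cat size_rev size_cat.
  have := leq_add (ltnW szh1) (ltnW szh2); rewrite addnn -doubleD leq_double => nle.
  by apply: leq_trans nle _; rewrite leq_add2l leq_addl.
- apply/hasP; exists g; last exact: sub1.
  by rewrite pedges_catl // pedges_rev mem_rev.
- apply/hasP; exists h; last exact: sub2.
  by rewrite catA pedges_catr.
Qed.

End HAdjacency.

(** * Tadpoles under the H-line graph operator *)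

Lemma sub_seq_lift (T : Type) (P : pred T) (S : subType P) (s : seq T) :
  all P s -> exists t : seq S, s = map val t.
Proof.
elim: s => [|x s IH] /=; first by exists [::].
by case/andP => Px /IH[t ->]; exists (Sub x Px :: t); rewrite /= SubK.
Qed.

Lemma subset_rcons (T : eqType) (s : seq T) x (a : {pred T}) :
  {subset s <= a} -> x \in a -> {subset rcons s x <= a}.
Proof. by move=> sa xa y; rewrite mem_rcons inE => /predU1P[->//|/sa]. Qed.

(* A tadpole with tail p and cycle a :: q; p = [::] is allowed and gives a
   cycle. *)
Definition lasso n (G : sgraph) (p : seq G) (a : G) (q : seq G) :=
  [&& gpath (p ++ a :: q), size (p ++ a :: q) == n, 1 < size q & sedge (last a q) a].

(** The order matters: read in [HL], this list is the vertex sequence of the next lasso, with the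
    closing edge as its last vertex. *)
Definition lasso_edges (G : sgraph) (p : seq G) (a : G) (q : seq G) :=
  rcons (pedges (p ++ a :: q)) [set last a q; a].

Section Lasso.
Variables (n : nat) (H : sgraph).
Hypothesis H_path : isomorphic H (path_graph n).
Hypothesis n_gt2 : 2 < n.

(** Walks are built on plain sets of vertices and lifted here; every set reached by an [H_adjacent]
    step is an edge, hence a vertex of [HL]. *)
Lemma HL_connect (G : sgraph) (e f : HL H G) :
  connect (@H_adjacent H G) (val e) (val f) -> connect sedge e f.
Proof.
case/connectP => s; elim: s e => [|g s IH] e /=.
  by move=> _ /val_inj ->; apply: connect0.
case/andP => eg gs fE; have gG := H_adjacent_edges eg.
by apply: connect_trans (IH (exist _ g gG) gs fE); apply: connect1.
Qed.

Variable G : sgraph.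
Implicit Types (p q : seq G) (a : G).

Lemma lasso_edges_uniq p a q : lasso n p a q -> uniq (lasso_edges p a q).
Proof.
case/and4P => /andP[u _] _ q_gt1 _; rewrite /lasso_edges rcons_uniq uniq_pedges // andbT.
have [uq pq] : uniq (a :: q) /\ forall x, x \in q -> x \notin rcons p a.
  move: u; rewrite cat_uniq => /and3P[_ ph uq]; split=> // x xq.
  move: uq => /= /andP[aq _]; have := hasPn ph x; rewrite inE xq orbT => /(_ isT) /= xp.
  by rewrite mem_rcons inE negb_or xp andbT; apply: contraTneq xq => ->.
rewrite pedges_cat mem_cat negb_or; apply/andP; split.
  have lq : last a q \in q by case: (q) q_gt1 => //= y r _; apply: mem_last.
  by apply: contra (pq _ lq) => /mem_pedges; apply; rewrite !inE eqxx.
have : uniq (cedges (a :: q)) by apply: uniq_cedges.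
by rewrite cedgesE rcons_uniq => /andP[].
Qed.

Lemma lasso_edges_sub p a q : lasso n p a q -> {subset lasso_edges p a q <= edges G}.
Proof.
case/and4P => /andP[_ /sorted_pedges ss] _ _ la; apply: subset_rcons => //.
by rewrite mem_edges.
Qed.

Lemma size_lasso_edges p a q : lasso n p a q -> size (lasso_edges p a q) = n.
Proof. by case/and4P => _ /eqP <- _ _; rewrite size_rcons size_pedges size_cat /= addnS. Qed.

(** A lasso has no isolated vertex, so its edges determine its vertices; this lets distinctness be
    tracked through edge sets alone. *)
Lemma lasso_edges_cover p a q x : lasso n p a q ->
  (x \in p ++ a :: q) = has (fun e : {set G} => x \in e) (lasso_edges p a q).
Proof.
case/and4P => _ /eqP sz q_gt1 _; apply/idP/hasP => [xs|[e]].
  have [|y _ xy] := mem_pedges_nbr xs; first by rewrite sz ltnW.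
  by exists [set x; y]; rewrite ?mem_rcons !inE ?xy ?orbT ?eqxx.
rewrite mem_rcons inE => /predU1P[->|/mem_pedges //]; last exact.
rewrite mem_cat !inE => /orP[]/eqP ->; rewrite ?eqxx ?orbT //.
by rewrite -in_cons mem_last orbT.
Qed.

(* The other Hamiltonian path of the lasso, running through the closing edge. *)
Lemma lasso_flip p a q : lasso n p a q ->
  gpath (p ++ a :: rev q) /\ size (p ++ a :: rev q) = n.
Proof.
case/and4P => /andP[u /sorted_pedges s] /eqP sz _ la; split; last first.
  by rewrite -sz !size_cat /= size_rev.
apply/andP; split.
  rewrite (@perm_uniq _ _ (p ++ a :: q)) // perm_cat2l perm_cons.
  by rewrite perm_rev.
apply/sorted_pedges => e; rewrite pedges_cat mem_cat => /orP[ep|].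
  by apply: s; rewrite pedges_cat mem_cat ep.
case/lastP: q la u s {sz} => // q y; rewrite last_rcons rev_rcons => ya _ s.
rewrite pedges_cons2 inE setUC => /predU1P[->|]; first by rewrite mem_edges.
rewrite -rev_rcons pedges_rev mem_rev => eq; apply: s.
by rewrite pedges_cat mem_cat -cat1s pedges_catr ?orbT.
Qed.

Lemma gpath_H_adjacent l x y z r : gpath (l ++ x :: y :: z :: r) ->
  size (l ++ x :: y :: z :: r) = n -> @H_adjacent H G [set x; y] [set y; z].
Proof. by move=> g sz; apply: (triple_H_adjacent H_path n_gt2 g); rewrite sz. Qed.

(** The path [p ++ a :: q] handles all consecutive pairs but the last; the closing edge and the one
    before it lie together on the flipped path. *)
Lemma lasso_edges_sorted p a q : lasso n p a q ->
  sorted (@H_adjacent H G) (lasso_edges p a q).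
Proof.
move=> L; have [fp fs] := lasso_flip L; have /and4P[g /eqP sz q_gt1 _] := L.
have ss : sorted (@H_adjacent H G) (pedges (p ++ a :: q)).
  by apply: (sorted_H_adjacent H_path n_gt2 g); rewrite sz.
rewrite /lasso_edges.
move: ss fp fs q_gt1; case/lastP: q {g sz L} => // q y; case/lastP: q => // q z.
have -> : p ++ a :: rcons (rcons q z) y = rcons (rcons (p ++ a :: q) z) y by rewrite !rcons_cat.
rewrite last_rcons pedges_rcons2 !rev_rcons => ss fp fs _.
have adj : H_adjacent H [set z; y] [set y; a].
  by rewrite H_adjacent_sym (setUC [set y]) (setUC [set z]); apply: (gpath_H_adjacent fp fs).
move: ss; case: (pedges _) => [|e s] /=; first by rewrite adj.
by rewrite !rcons_path last_rcons adj andbT.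
Qed.

(** A nonempty tail gives up its edge [[set b; a]] at the cycle: that edge is adjacent to the first
    cycle edge along the given path and to the closing edge along the flipped one, so the cycle
    gains a vertex and the tail loses one. An empty tail leaves a cycle on [n] edges. *)
Lemma lasso_step p a q : lasso n p a q ->
  exists (p' : seq (HL H G)) (a' : HL H G) (q' : seq (HL H G)),
    [/\ lasso n p' a' q', size p' = (size p).-1 &
    [seq val e | e <- p' ++ a' :: q'] = lasso_edges p a q].
Proof.
move=> L; have u := lasso_edges_uniq L; have ss := lasso_edges_sorted L.
have [fp fs] := lasso_flip L; have /and4P[g /eqP sz q_gt1 la] := L.
have [P [A [Q [LE sP Q_gt1 QA]]]] : exists (P : seq {set G}) A Q,
    [/\ lasso_edges p a q = P ++ A :: Q, size P = (size p).-1, 1 < size Q &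
        H_adjacent H (last A Q) A].
  case/lastP: p L u ss fp fs g sz => [|p b] L u ss fp fs g sz.
    case: q q_gt1 {L} u ss fp fs la g sz => // y q q_gt1 u ss fp fs la g sz.
    exists [::], [set a; y], (rcons (pedges (y :: q)) [set last y q; a]); split=> //.
      by rewrite size_rcons size_pedges.
    rewrite last_rcons; case/lastP: q q_gt1 la u g sz {ss fp fs} => // q z _ la _ g sz.
    rewrite last_rcons; move/andP: g => [ug /sorted_pedges sg].
    (* The cycle is cut open between [z] and its predecessor, giving the path [z :: a :: y :: q]. *)
    apply: (@gpath_H_adjacent [::] z a y q); last by rewrite -sz /= size_rcons.
    apply/andP; split; first by move: ug; rewrite cat0s -!rcons_cons rcons_uniq.
    apply/sorted_pedges => e; rewrite /= pedges_cons2 inE => /predU1P[->|eq].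
      by rewrite mem_edges; rewrite /= last_rcons in la.
    by apply: sg; rewrite cat0s -!rcons_cons -cats1 pedges_catl.
  exists (pedges (rcons p b)), [set b; a], (rcons (pedges (a :: q)) [set last a q; a]); split.
  - by rewrite /lasso_edges cat_rcons pedges_cat pedges_cons2 rcons_cat.
  - by rewrite size_pedges.
  - by rewrite size_rcons size_pedges /= ; case: (q) q_gt1.
  - rewrite last_rcons H_adjacent_sym; case/lastP: q q_gt1 fp fs {L u ss g sz la} => // q z _.
    rewrite last_rcons rev_rcons cat_rcons => fp fs.
    by rewrite (setUC [set z]); apply: (gpath_H_adjacent fp fs).
have [|L' LE'] := @sub_seq_lift _ (mem (edges G)) (HL H G) (lasso_edges p a q).
  by apply/allP; apply: lasso_edges_sub L.
have [p' [a' [q' [L'E PE AE QE]]]] : exists (p' : seq (HL H G)) (a' : HL H G) (q' : seq (HL H G)),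
    [/\ L' = p' ++ a' :: q', map val p' = P, val a' = A & map val q' = Q].
  have := LE'; rewrite LE => /esym L'E.
  have := cat_take_drop (size P) L'; case dE: (drop (size P) L') => [|a' q'] tE.
    have : size P < size (map val L') by rewrite L'E size_cat /= addnS ltnS leq_addr.
    have := size_drop (size P) L'; rewrite dE size_map => /esym/eqP.
    by rewrite subn_eq0 leqNgt => /negPf ->.
  have : map val (drop (size P) L') = A :: Q by rewrite map_drop L'E drop_size_cat.
  rewrite dE => -[aA qQ]; exists (take (size P) L'), a', q'; split=> //.
  by rewrite map_take L'E take_size_cat.
exists p', a', q'; rewrite -L'E LE' -sP -PE size_map; split=> //.
apply/and4P; rewrite -L'E; split.
- rewrite /gpath; move: u ss; rewrite LE' map_inj_uniq; last exact: val_inj.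
  by move=> ->; rewrite sorted_map.
- by rewrite -(size_map val) -LE' size_lasso_edges.
- by rewrite -(size_map val) QE.
- by move: QA; rewrite -QE -AE last_map.
Qed.
End Lasso.

(** * Growth *)

Lemma connect_exit (T : finType) (r : rel T) (A : {set T}) x y :
  x \in A -> y \notin A -> connect r x y -> exists u v, [/\ u \in A, v \notin A & r u v].
Proof.
move=> + yA /connectP[p]; elim: p x => [|z p IH] x xA /=.
  by move=> _ yx; rewrite yx xA in yA.
case/andP => xz pz yz; have [zA|zA] := boolP (z \in A); first exact: (IH z).
by exists x, z.
Qed.

Section Counting.
Variable G : sgraph.
Implicit Types (A : {set G}) (x y z : G) (s : seq G).

Definition induced_edges A := [set e in edges G | e \subset A].

(** As [y] is outside [A], its edges to [N] are not among those induced by [A]. *)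
Lemma card_induced_edges_add A (N : {set G}) y : y \notin A -> N \subset A ->
  {in N, forall z, sedge y z} -> #|induced_edges A| + #|N| <= #|induced_edges (y |: A)|.
Proof.
move=> yA NA yN; pose F := [set [set y; z] | z in N].
have <- : #|F| = #|N| by apply: card_imset => z z' /set2_inj.
rewrite -cardsUI (_ : induced_edges A :&: F = set0) ?cards0 ?addn0.
  apply: subset_leq_card; apply/subsetP => e; rewrite inE => /orP[|/imsetP[z zN ->]].
    rewrite !inE => /andP[-> eA]; apply: subset_trans eA _; exact: subsetUr.
  by rewrite inE mem_edges yN //= subUset !sub1set !inE eqxx (subsetP NA z zN) orbT.
apply/setP => e; rewrite !inE; apply/negP => /andP[/andP[_ /subsetP eA] /imsetP[z _ eE]].
by case/negP: yA; apply: eA; rewrite eE !inE eqxx.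
Qed.

Lemma cycle_neighbours (c : seq G) y : uniq c -> cycle sedge c -> 2 < size c -> y \in c ->
  exists z1 z2, [/\ z1 != z2, z1 \in c, z2 \in c, sedge y z1 & sedge y z2].
Proof.
move=> uc cc c_gt2 /rot_to[i t tE].
have memt z : z \in y :: t -> z \in c by rewrite -tE mem_rot.
move: uc cc c_gt2; rewrite -(rot_uniq i) -(rot_cycle i) -(size_rot i c) tE.
case: t tE memt => [|z1 t] // _; case/lastP: t => // t z2 memt ut.
rewrite /= !rcons_path last_rcons => /and3P[yz1 _ z2y] _.
exists z1, z2; split=> //; last by rewrite sedge_sym.
- by move: ut => /= /andP[_ /andP[+ _]]; apply: contraNneq => ->; rewrite mem_rcons mem_head.
- by apply: memt; rewrite !inE eqxx orbT.
- by apply: memt; rewrite !inE mem_rcons mem_head !orbT.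
Qed.

End Counting.

Section Growth.
Variables (n : nat) (H : sgraph).
Hypothesis H_path : isomorphic H (path_graph n).
Hypothesis n_gt2 : 2 < n.

Lemma lasso_cycle (G : sgraph) (a : G) q : lasso n [::] a q ->
  [/\ uniq (a :: q), cycle sedge (a :: q), size (a :: q) = n & sorted sedge (a :: q)].
Proof.
case/and4P => /andP[u s] /eqP sz _ la; split=> //.
by rewrite /= rcons_path la andbT.
Qed.

Definition component (G : sgraph) (a : G) := [set x | connect sedge a x].

(* Along a growing vertex set every new vertex brings an edge, and the one
   completing the second cycle brings two. *)
Lemma bicyclic_card (G : sgraph) (a b : G) q t :
  lasso n [::] a q -> lasso n [::] b t -> connect sedge a b ->
  ~ lasso_edges [::] a q =i lasso_edges [::] b t ->
  #|component a| < #|induced_edges (component a)|.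
Proof.
move=> Lq Lt ab Nqt; have [uq cq szq sq] := lasso_cycle Lq; have [ut ct szt st] := lasso_cycle Lt.
pose Vq := [set x in a :: q]; pose Vt := [set x in b :: t].
have Vt_comp : Vt \subset component a.
  apply/subsetP => x; rewrite !inE => xt; apply: connect_trans ab _.
  by apply: (path_connect st); rewrite inE.
(* Invariant for sets [A] between the first cycle and the component: at least as many edges as
   vertices, and strictly more once the second cycle is inside. *)
suff main m A : #|component a :\: A| = m -> Vq \subset A -> A \subset component a ->
    #|A| <= #|induced_edges A| -> (Vt \subset A -> #|A| < #|induced_edges A|) ->
    #|component a| < #|induced_edges (component a)|.
  have card_edges p (c : G) r (A : {set G}) : lasso n p c r -> {subset p ++ c :: r <= A} ->
      [set e in lasso_edges p c r] \subset induced_edges A /\ #|[set e in lasso_edges p c r]| = n.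
    move=> L sA; split; last first.
      by rewrite cardsE -[RHS](size_lasso_edges L); apply/card_uniqP; apply: lasso_edges_uniq L.
    apply/subsetP => e; rewrite inE => eL; rewrite inE (lasso_edges_sub L) //=.
    apply/subsetP => x xe; apply: sA; rewrite (lasso_edges_cover n_gt2 _ L).
    by apply/hasP; exists e.
  have cVq : #|Vq| = n by rewrite cardsE (card_uniqP uq).
  have [|sEq cEq] := card_edges [::] a q Vq Lq; first by move=> x xq; rewrite inE.
  apply: (main _ Vq erefl).
  - exact: subxx.
  - by apply/subsetP => x; rewrite !inE => xq; apply: (path_connect sq); rewrite inE.
  - by rewrite cVq -cEq subset_leq_card.
  (* If both cycles lie on [Vq] and it induces only [n] edges, each cycle consists of all of them,
     so their edge sets agree. *)
  - move=> Vtq; have [|sEt cEt] := card_edges [::] b t Vq Lt.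
      by move=> x xt; apply: (subsetP Vtq); rewrite inE.
    rewrite cVq ltnNge; apply/negP => le_n; case: Nqt.
    have eqE (E : {set {set G}}) : E \subset induced_edges Vq -> #|E| = n -> E = induced_edges Vq.
      by move=> sE cE; apply/eqP; rewrite eqEcard sE cE.
    have := eqE _ sEq cEq; rewrite -(eqE _ sEt cEt) => /setP eL e.
    by have := eL e; rewrite !inE.
elim/ltn_ind: m A => m IH A Am VqA AX Ale Alt.
have [XA|/subsetPn[y0 y0X y0A]] := boolP (component a \subset A).
  have AE : A = component a by apply/eqP; rewrite eqEsubset AX XA.
  by rewrite -AE; apply: Alt; rewrite AE.
have aA : a \in A by apply: (subsetP VqA); rewrite inE mem_head.
have [u [v [uA vA uv]]] : exists u v, [/\ u \in A, v \notin A & sedge u v].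
  by apply: (connect_exit aA y0A); rewrite inE in y0X.
have vX : v \in component a.
  have := subsetP AX u uA; rewrite !inE => au.
  by apply: connect_trans au (connect1 uv).
have add1 : #|A| < #|induced_edges (v |: A)|.
  have := @card_induced_edges_add G A [set u] v vA; rewrite cards1 addn1 => h.
  apply: leq_ltn_trans Ale (h _ _); first by rewrite sub1set.
  by move=> z /set1P ->; rewrite sedge_sym.
apply: (IH _ _ (v |: A) erefl).
- rewrite -Am; apply: proper_card; apply/properP; split; first exact/setDS/subsetUr.
  by exists v; rewrite !inE ?eqxx // vA; move: vX; rewrite inE.
- exact: subset_trans VqA (subsetUr _ _).
- by rewrite subUset sub1set vX AX.
- by rewrite cardsU1 vA add1n.
rewrite cardsU1 vA add1n => VtA'; have [VtA|VtA] := boolP (Vt \subset A).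
  have := @card_induced_edges_add G A [set u] v vA; rewrite cards1 addn1 => h.
  apply: leq_ltn_trans (Alt VtA) (h _ _); first by rewrite sub1set.
  by move=> z /set1P ->; rewrite sedge_sym.
(* [v] completes the second cycle, so its two neighbours there are already in [A]. *)
have vt : v \in b :: t.
  apply: contraR VtA => vt; apply/subsetP => x xt; have := subsetP VtA' x xt.
  by rewrite !inE => /predU1P[xv|//]; move: xt; rewrite xv inE (negPf vt).
have [|z1 [z2 [z12 z1t z2t vz1 vz2]]] := cycle_neighbours ut ct _ vt; first by rewrite szt.
have nA z : z \in b :: t -> sedge v z -> z \in A.
  move=> zt vz; have : z \in v |: A by apply: (subsetP VtA'); rewrite inE.
  by rewrite !inE => /predU1P[zv|//]; move: vz; rewrite zv sedge_irr.
have := @card_induced_edges_add G A [set z1; z2] v vA; rewrite cards2 z12 addn2 => h.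
apply: leq_trans (h _ _) => //.
- by rewrite subUset !sub1set !nA.
- by move=> z /set2P[->|->].
Qed.

End Growth.

(** * Divergence from two distinct lassos *)

Section Divergence.
Variables (n : nat) (H : sgraph).
Hypothesis H_path : isomorphic H (path_graph n).
Hypothesis n_gt2 : 2 < n.

Lemma gpath_through (G : sgraph) (s : seq G) e : gpath s -> n <= size s -> e \in pedges s ->
  exists t, [/\ gpath t, size t = n, e \in pedges t & {subset t <= s}].
Proof.
move=> /andP[us /sorted_pedges ss] sn /pedgesP[l [x [y [r [sE eE]]]]].
have [|l1 [l2 [r1 [r2 [lE rE sz]]]]] := @window _ n l [:: x; y] r.
  by rewrite ltnW //= -[x :: _]/([:: x; y] ++ r) in sE *; rewrite -sE.
have {}sE : s = l1 ++ (l2 ++ [:: x; y] ++ r1) ++ r2 by rewrite sE lE rE -!catA.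
exists (l2 ++ [:: x; y] ++ r1); split=> //.
- apply/andP; split; first by move: us; rewrite sE !cat_uniq => /and3P[_ _ /andP[]].
  by apply/sorted_pedges => f ft; apply: ss; rewrite sE pedges_catr // pedges_catl.
- by apply/pedgesP; exists l2, x, y, r1.
- by move=> z zt; rewrite sE mem_cat mem_cat zt orbT.
Qed.

(* An edge of the component of a cycle on n vertices either is a chord of the
   cycle or is reached by a path leaving the cycle, after a full turn. *)
Lemma cycle_edge_path (G : sgraph) (c : seq G) x y z : uniq c -> cycle sedge c -> size c = n ->
  z \in c -> connect sedge z x -> sedge x y ->
  exists s, [/\ gpath s, n <= size s & [set x; y] \in pedges s].
Proof.
move=> uc cc sc zc zx xy.
have chord u v : u \in c -> sedge u v ->
    exists s, [/\ gpath s, n <= size s & [set u; v] \in pedges s].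
  case/rot_to => i c' cE uv.
  move: uc cc sc; rewrite -(rot_uniq i) -(rot_cycle i) -(size_rot i c) cE => uc cc sc.
  have sE : {subset pedges (u :: c') <= edges G}.
    by apply/sorted_pedges; move: cc; rewrite /= rcons_path => /andP[].
  have vNu : v != u by apply: contraTneq uv => ->; rewrite sedge_irr.
  have [vc|vc] := boolP (v \in c'); last first.
    exists (v :: u :: c'); split; last by rewrite pedges_cons2 setUC mem_head.
      apply/andP; split; first by rewrite cons_uniq inE negb_or vNu vc.
      apply/sorted_pedges => e; rewrite pedges_cons2 inE => /predU1P[->|/sE //].
      by rewrite setUC mem_edges.
    by rewrite -sc leqnSn.
  (* The arc [c2] is run backwards into [v], then comes the edge to [u], then [c1]; all [n] vertices
     of the cycle are used. *)
  case/splitPr: vc uc sE sc {cE cc} => c1 c2 uc sE sc.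
  exists (rev c2 ++ v :: u :: c1); split.
  - apply/andP; split.
      rewrite -(@perm_uniq _ (u :: c1 ++ v :: c2)) //; apply/permP => q.
      by rewrite /= !count_cat count_rev /=; clear; lia.
    apply/sorted_pedges => e; rewrite pedges_cat -rev_cons pedges_rev mem_cat mem_rev.
    rewrite pedges_cons2 inE => /or3P[e2|/eqP->|e1].
    + by apply: sE; rewrite -cat_cons pedges_catr.
    + by rewrite setUC mem_edges.
    + by apply: sE; rewrite -cat_cons pedges_catl.
  - by rewrite -sc /= !size_cat size_rev /= !addnS addnC.
  - by rewrite pedges_cat mem_cat pedges_cons2 setUC mem_head orbT.
have [xc|xNc] := boolP (x \in c); first exact: chord.
have [yc|yNc] := boolP (y \in c); first by rewrite setUC; apply: chord; rewrite // sedge_sym.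
have [p zp xp] := connectP zx; case/shortenP: zp xp => w zw uw _ xw.
have [l [z' [r [wE /= zc' rc]]]] : exists l z' r, [/\ z :: w = l ++ z' :: r, mem c z' & ~~ has (mem c) r].
  by apply: split_last; rewrite /= zc.
have [r' r'E] : exists r', r = rcons r' x.
  have := congr1 (last z) wE; rewrite last_cat /= -xw.
  case/lastP: r rc wE => [|r' x'] _ _ /= E; last by exists r'; rewrite E last_rcons.
  by case/negP: xNc; rewrite E.
have [i c' cE] := rot_to zc'.
move: uc cc sc; rewrite -(rot_uniq i) -(rot_cycle i) -(size_rot i c) cE => uc cc sc.
have sE : {subset pedges (z' :: c') <= edges G}.
  by apply/sorted_pedges; move: cc; rewrite /= rcons_path => /andP[].
have rE : {subset pedges (z' :: r) <= edges G}.
  by move=> e er; apply: (sorted_pedges (z :: w) zw); rewrite wE pedges_catr.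
have ur : uniq (z' :: r) by move: uw; rewrite wE cat_uniq => /and3P[].
have memc u : (u \in c) = (u \in z' :: c') by rewrite -cE mem_rot.
(* If [y] is already on the way to [x], the route jumps from [y] straight to [x]; otherwise it is
   prolonged by [y]. *)
have [r1 [ur1 r1c r1E xyr1]] : exists r1, [/\ uniq r1, ~~ has (mem c) r1,
    {subset pedges (z' :: r1) <= edges G} & [set x; y] \in pedges r1].
  have [yr|yr] := boolP (y \in r').
    case/splitPr: yr r'E => ra rb r'E.
    have sub : subseq (rcons (rcons ra y) x) r.
      rewrite r'E -cats1 -[rcons (_ ++ _) _]cats1 cat_subseq //.
      by rewrite -cats1 cat_subseq // sub1seq mem_head.
    exists (rcons (rcons ra y) x); split.
    - by apply: subseq_uniq sub _; move: ur => /= /andP[].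
    - by apply: contra rc => /hasP[u /(mem_subseq sub) ur' uc']; apply/hasP; exists u.
    - move=> e; rewrite -!rcons_cons pedges_rcons2 mem_rcons inE => /predU1P[->|er].
        by rewrite setUC mem_edges.
      by apply: rE; rewrite r'E rcons_cat -cat_cons -cat_rcons pedges_catl.
    - by rewrite pedges_rcons2 mem_rcons setUC mem_head.
  exists (rcons r y); split.
  - rewrite rcons_uniq r'E mem_rcons inE negb_or yr andbT -r'E.
    move: ur => /= /andP[_ ->]; rewrite andbT.
    by apply: contraTneq xy => ->; rewrite sedge_irr.
  - by rewrite has_rcons negb_or rc andbT.
  - move=> e; rewrite -rcons_cons (pedges_rcons z') // mem_rcons inE => /predU1P[->|/rE //].
    by rewrite r'E /= last_rcons mem_edges.
  - by rewrite r'E pedges_rcons2 mem_rcons mem_head.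
exists (rev c' ++ z' :: r1); split.
- apply/andP; split.
    rewrite -cat_rcons -rev_cons cat_uniq rev_uniq uc ur1 andbT andTb.
    by apply: contra r1c => /hasP[u ur1']; rewrite /= mem_rev -memc => uc'; apply/hasP; exists u.
  apply/sorted_pedges => e; rewrite pedges_cat -rev_cons pedges_rev mem_cat mem_rev.
  by case/orP => [/sE|/r1E].
- by rewrite size_cat size_rev /= -addSnnS -sc leq_addr.
- by rewrite pedges_catr // -cat1s pedges_catr.
Qed.

Lemma lasso_mem_edges (G : sgraph) (p : seq G) a q : lasso n p a q ->
  exists2 e, e \in pedges (p ++ a :: q) & e \in lasso_edges p a q.
Proof.
case/and4P => _ _; case: q => // y q _ _; exists [set a; y].
  by rewrite pedges_cat mem_cat pedges_cons2 mem_head orbT.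
by rewrite mem_rcons inE pedges_cat mem_cat pedges_cons2 mem_head !orbT.
Qed.

Lemma lasso_connect_path (G : sgraph) (p : seq G) a q s x e f :
  lasso n p a q -> gpath s -> size s = n -> x \in s -> connect sedge a x ->
  e \in lasso_edges p a q -> f \in pedges s -> connect (@H_adjacent H G) e f.
Proof.
move=> L gs sn xs ax eL fs; have [g gp gL] := lasso_mem_edges L.
have inL := sorted_connect (@H_adjacent_sym H G) (lasso_edges_sorted H_path n_gt2 L).
apply: connect_trans (inL _ _ eL gL) _; have /and4P[gpp /eqP sz _ _] := L.
apply: (connected_paths H_path n_gt2 gpp sz gs sn _ xs ax gp fs).
by rewrite mem_cat mem_head orbT.
Qed.

Lemma lasso_connect (G : sgraph) (p : seq G) a q p' a' q' e f :
  lasso n p a q -> lasso n p' a' q' -> connect sedge a a' ->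
  e \in lasso_edges p a q -> f \in lasso_edges p' a' q' ->
  connect (@H_adjacent H G) e f.
Proof.
move=> L L' aa' eL fL'; have [h hs hL'] := lasso_mem_edges L'.
have inL' := sorted_connect (@H_adjacent_sym H G) (lasso_edges_sorted H_path n_gt2 L').
apply: connect_trans _ (inL' _ _ hL' fL'); have /and4P[gp' /eqP sz' _ _] := L'.
apply: (lasso_connect_path L gp' sz' _ aa' eL hs).
by rewrite mem_cat mem_head orbT.
Qed.

(* The two lassos of the step are distinct as subgraphs because the old edges
   are the new vertices. *)
Lemma two_lassos_step (G : sgraph) (p p' : seq G) a a' q q' :
  lasso n p a q -> lasso n p' a' q' -> connect sedge a a' ->
  ~ lasso_edges p a q =i lasso_edges p' a' q' ->
  exists (p1 p1' : seq (HL H G)) (b b' : HL H G) (q1 q1' : seq (HL H G)),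
    [/\ lasso n p1 b q1 /\ size p1 = (size p).-1,
        lasso n p1' b' q1' /\ size p1' = (size p').-1,
        connect sedge b b', val b \in lasso_edges p a q &
        ~ lasso_edges p1 b q1 =i lasso_edges p1' b' q1'].
Proof.
move=> L L' aa' LL'.
have [p1 [b [q1 [L1 sz1 LE1]]]] := lasso_step H_path n_gt2 L.
have [p1' [b' [q1' [L1' sz1' LE1']]]] := lasso_step H_path n_gt2 L'.
have bL : val b \in lasso_edges p a q by rewrite -LE1 map_f // mem_cat mem_head orbT.
have bL' : val b' \in lasso_edges p' a' q' by rewrite -LE1' map_f // mem_cat mem_head orbT.
exists p1, p1', b, b', q1, q1'; split=> //.
  by apply: HL_connect; apply: lasso_connect L L' aa' bL bL'.
move=> E; apply: LL' => e; rewrite -LE1 -LE1'; apply: eq_mem_map => {}e.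
by rewrite (lasso_edges_cover n_gt2 _ L1) (lasso_edges_cover n_gt2 _ L1'); apply: eq_has_r.
Qed.

(** Only one component is measured: elsewhere the number of vertices may drop from one iterate to
    the next. *)
Lemma two_cycles_growth k (G : sgraph) (a b : G) q t :
  lasso n [::] a q -> lasso n [::] b t -> connect sedge a b ->
  ~ lasso_edges [::] a q =i lasso_edges [::] b t ->
  #|component a| + k <= #|HL_iter H k G|.
Proof.
elim: k G a b q t => [|k IH] G a b q t L L' ab LL'; first by rewrite addn0 max_card.
rewrite /HL_iter iterSr -/(HL_iter H k (HL H G)).
have [p1 [p1' [c [c' [q1 [q1' [[L1 s1] [L1' s1'] cc' cL L1L1']]]]]]] := two_lassos_step L L' ab LL'.
(* Both tails stay empty, as [0.-1 = 0]. *)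
case: p1 L1 s1 L1L1' => // L1 _; case: p1' L1' s1' => // L1' _ L1L1'.
apply: leq_trans (IH _ _ _ _ _ L1 L1' cc' L1L1'); rewrite addnS -addSn leq_add2r.
apply: leq_trans (bicyclic_card n_gt2 L L' ab LL') _.
rewrite -(card_imset (mem (component c)) val_inj); apply: subset_leq_card.
apply/subsetP => e; rewrite inE => /andP[eG eX].
have [[x y]] := imsetP eG; rewrite inE /= => xy eE.
have xX : connect sedge a x.
  by have := subsetP eX x; rewrite eE !inE eqxx; apply.
have [ua ca sa ssa] := lasso_cycle L.
have [s [gs sn es]] := cycle_edge_path ua ca sa (mem_head _ _) xX xy.
rewrite -eE in es; have [s' [gs' sn' es' _]] := gpath_through gs sn es.
apply/imsetP; exists (exist _ e eG) => //; rewrite inE; apply: HL_connect => /=.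
apply: (lasso_connect_path L gs' sn' _ xX cL es').
by apply: mem_pedges es' _; rewrite eE !inE eqxx.
Qed.

(** Induction on a common bound for both tail lengths: a tail that is already empty stays empty
    while the other shrinks. Once both are empty, each step adds a vertex, so [N] steps suffice. *)
Lemma two_lassos_diverge r (G : sgraph) (p p' : seq G) a a' q q' :
  size p <= r -> size p' <= r ->
  lasso n p a q -> lasso n p' a' q' -> connect sedge a a' ->
  ~ lasso_edges p a q =i lasso_edges p' a' q' ->
  diverges_by_order H G.
Proof.
elim: r G p p' a a' q q' => [|r IH] G p p' a a' q q'.
  rewrite !leqn0 !size_eq0 => /eqP -> /eqP -> L L' aa' LL' N _; exists N.
  by apply: leq_trans (two_cycles_growth N L L' aa' LL'); apply: leq_addl.
move=> pr pr' L L' aa' LL' N N_gt0.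
have [p1 [p1' [c [c' [q1 [q1' [[L1 s1] [L1' s1'] cc' _ L1L1']]]]]]] := two_lassos_step L L' aa' LL'.
have [||k kN] := IH _ _ _ _ _ _ _ _ _ L1 L1' cc' L1L1' N N_gt0.
- by rewrite s1 -subn1 leq_subLR add1n.
- by rewrite s1' -subn1 leq_subLR add1n.
by exists k.+1; rewrite /HL_iter iterSr.
Qed.

End Divergence.

(** * From members of [in_delta] to lassos *)

Lemma tadpole_lasso m r : 2 < m -> exists (p : seq (tadpole m r)) a q,
  [/\ lasso (r + m) p a q, lasso_edges p a q =i edges (tadpole m r) &
      forall u, u \in p ++ a :: q].
Proof.
case: m => // m m_gt2; pose T : finType := ('I_m.+1 + 'I_r)%type.
(* The tail is listed from its free end, so that its vertex 0 comes just before vertex 0 of the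
   cycle, whose length is now [m.+1]. *)
pose p := rev [seq inr j : T | j <- enum 'I_r].
pose q := [seq inl i : T | i <- [seq lift ord0 i | i <- enum 'I_m]].
pose a : T := inl ord0; pose U := p ++ a :: q.
have UE : U = p ++ [seq inl i : T | i <- enum 'I_m.+1] by rewrite enum_ordSl.
have Usz : size U = r + m.+1 by rewrite UE size_cat size_rev 2!size_map !size_enum_ord.
(* [pos] inverts [nth a U]; adjacency becomes arithmetic on positions, the closing edge joining
   positions [r + m] and [r]. *)
pose pos (u : T) := match u with inl i => r + i | inr j => r - j.+1 end.
have pos_lt u : pos u < size U by rewrite Usz; case: u => [i|j] /=; [have := ltn_ord i|have := ltn_ord j]; lia.
have posK u : nth a U (pos u) = u.
  rewrite UE nth_cat size_rev size_map size_enum_ord; case: u => [i|j] /=.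
    by rewrite ltnNge leq_addr /= addKn (nth_map ord0) ?size_enum_ord // nth_ord_enum.
  have jr := ltn_ord j; have -> : r - j.+1 < r by lia.
  rewrite nth_rev size_map size_enum_ord; last by lia.
  have -> : r - (r - j.+1).+1 = j by lia.
  by rewrite (nth_map j) ?size_enum_ord // nth_ord_enum.
have uU : uniq U.
  have u1 : uniq [seq inr j : T | j <- enum 'I_r].
    by rewrite map_inj_uniq ?enum_uniq // => ? ? [].
  have u2 : uniq [seq inl i : T | i <- enum 'I_m.+1].
    by rewrite map_inj_uniq ?enum_uniq // => ? ? [].
  rewrite UE cat_uniq rev_uniq u1 u2 andbT; apply/hasPn => _ /mapP[i _ ->].
  by rewrite /= mem_rev; apply/mapP => -[].
have lU : last a q = inl ord_max.
  have -> : last a q = last a U by rewrite /U last_cat.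
  by rewrite -nth_last Usz addnS /= -[r + m]/(pos (inl ord_max)) posK.
have posE u v : (pos u == pos v) = (u == v) by apply: inj_eq; apply: can_inj posK.
pose TG := tadpole m.+1 r.
have edgeE (u v : TG) : sedge u v = ([set u; v] \in @lasso_edges TG p a q).
  rewrite /lasso_edges mem_rcons inE -/U lU.
  have -> : ([set u; v] \in @pedges TG U) = ((pos u).+1 == pos v) || ((pos v).+1 == pos u).
    by rewrite -{1}(posK u) -{1}(posK v) (pedges_nth a uU).
  have -> : ([set u; v] == [set inl ord_max; a]) =
     ((pos u == r + m) && (pos v == r + 0)) || ((pos u == r + 0) && (pos v == r + m)).
    rewrite -[r + m]/(pos (inl ord_max)) -[r + 0]/(pos a) !posE.
    apply/eqP/orP => [/set2_eq[[-> ->]|[-> ->]]|[]/andP[/eqP -> /eqP ->] //].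
    - by left; rewrite !eqxx.
    - by right; rewrite !eqxx.
    - by rewrite setUC.
  have modE (i : 'I_m.+1) : i.+1 %% m.+1 = if i == m :> nat then 0 else i.+1.
    by case: eqP => [->|im]; rewrite ?modnn // modn_small //; have := ltn_ord i; lia.
  case: u v => [i|i] [j|j]; rewrite /= /cycle_rel /path_rel -?val_eqE /= ?modE.
  - move: (ltn_ord i) (ltn_ord j); case: (@eqP _ (i : nat) m) => im; case: (@eqP _ (j : nat) m) => jm; lia.
  - by have := ltn_ord i; have := ltn_ord j; lia.
  - by have := ltn_ord i; have := ltn_ord j; lia.
  - by have := ltn_ord i; have := ltn_ord j; lia.
have subE : {subset @lasso_edges TG p a q <= edges TG}.
  move=> e; rewrite mem_rcons inE => h.
  have [x [y eE]] : exists x y : TG, e = [set x; y].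
    by case/predU1P: h => [->|/pedgesP[l [x [y [? [_ ->]]]]]]; [exists (last a q), a|exists x, y].
  by rewrite eE mem_edges edgeE -eE mem_rcons inE.
exists p, a, q; split.
- apply/and4P; split; rewrite ?Usz //.
  + apply/andP; split=> //; apply/sorted_pedges => e eU.
    by apply: subE; rewrite mem_rcons inE eU orbT.
  + by rewrite 2!size_map size_enum_ord.
  + by rewrite edgeE mem_rcons mem_head.
- move=> e; apply/idP/idP; first exact: subE.
  by case/imsetP => -[u v]; rewrite inE /= => uv ->; rewrite -edgeE.
- by move=> u; rewrite -/U -(posK u) mem_nth.
Qed.

Lemma delta_lasso n (G : sgraph) (S : subgraph G) : in_delta n (graph_of_subgraph S) ->
  exists (p : seq G) a q, [/\ lasso n p a q, lasso_edges p a q =i subE S &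
    p ++ a :: q =i subV S].
Proof.
case=> m [r [m_gt2 _ <- /isomorphic_sym/isomorphicP[g [g' gK g'K] gE]]].
pose h (u : tadpole m r) : G := val (g u).
have hI : injective h by move=> u v /val_inj /(can_inj gK).
have hE u v : ([set h u; h v] \in subE S) = sedge u v by rewrite -gE.
have hV u : h u \in subV S by apply: (valP (g u)).
have hS x : x \in subV S -> exists u, x = h u.
  by move=> xS; exists (g' (exist _ x xS)); rewrite /h g'K.
have [SE SV] : {subset subE S <= edges G} /\ forall e x, e \in subE S -> x \in e -> x \in subV S.
  have /andP[/subsetP sE /forall_inP sV] := valP S; split=> // e x eS.
  exact: (subsetP (sV e eS)).
have sub e : (e \in subE S) = (e \in [seq h @: f | f : {set tadpole m r} <- enum (edges (tadpole m r))]).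
  apply/idP/mapP => [eS|[f]]; last first.
    rewrite mem_enum => /imsetP[[u v]]; rewrite inE /= => uv -> ->.
    by rewrite imsetU !imset_set1 hE.
  have /imsetP[[x y]] := SE _ eS; rewrite inE /= => _ eE.
  have [|u xu] := hS x; first by apply: SV eS _; rewrite eE !inE eqxx.
  have [|v yv] := hS y; first by apply: SV eS _; rewrite eE !inE eqxx orbT.
  exists [set u; v]; last by rewrite imsetU !imset_set1 -xu -yv.
  by rewrite mem_enum; apply: etrans (mem_edges u v) _; rewrite -hE -xu -yv -eE.
have [p [a [q [L LE LV]]]] := @tadpole_lasso m r m_gt2.
have LhE : lasso_edges (map h p) (h a) (map h q) = [seq h @: f | f : {set tadpole m r} <- lasso_edges p a q].
  by rewrite /lasso_edges map_rcons -map_cons -map_cat pedges_map last_map imsetU !imset_set1.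
have LhS : lasso_edges (map h p) (h a) (map h q) =i subE S.
  move=> e; rewrite LhE sub; apply: eq_mem_map => f.
  by rewrite LE mem_enum.
exists (map h p), (h a), (map h q); split=> //.
  have /and4P[/andP[u _] sz q_gt1 la] := L.
  apply/and4P; rewrite -map_cons -map_cat !size_map; split=> //.
    apply/andP; split; first by rewrite map_inj_uniq.
    apply/sorted_pedges => e eh; apply: SE; rewrite -LhS mem_rcons inE.
    by rewrite -map_cons -map_cat eh orbT.
  by rewrite last_map -mem_edges; apply: SE; rewrite hE.
move=> x; rewrite -map_cons -map_cat; apply/mapP/idP => [[u _ ->]|/hS[u ->]]; first exact: hV.
by exists u.
Qed.

Theorem theorem2p8 (n : nat) (H G : sgraph) (C : {set G})
    (G1 G2 : subgraph G) :
  4 <= n ->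
  isomorphic H (path_graph n) ->
  C \in components G ->
  subV G1 \subset C -> subV G2 \subset C ->
  in_delta n (graph_of_subgraph G1) ->
  in_delta n (graph_of_subgraph G2) ->
  G1 <> G2 ->
  diverges_by_order H G.
Proof.
move=> n_gt3 H_path /imsetP[z _ CE] G1C G2C /delta_lasso[p1 [a1 [q1 [L1 E1 V1]]]].
move=> /delta_lasso[p2 [a2 [q2 [L2 E2 V2]]]] G12.
have n_gt2 : 2 < n by apply: ltnW.
have sym : connect_sym (@sedge G) by apply: sym_connect_sym; apply: sedge_sym.
have inC x : x \in C -> connect sedge z x by rewrite CE inE => /andP[].
(* The larger tail length bounds the number of steps until both tails have vanished. *)
apply: (two_lassos_diverge H_path n_gt2 (leq_maxl (size p1) (size p2)) (leq_maxr _ _) L1 L2).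
  apply: (@connect_trans _ _ z).
    by rewrite sym; apply: inC; apply: (subsetP G1C); rewrite -V1 mem_cat mem_head orbT.
  by apply: inC; apply: (subsetP G2C); rewrite -V2 mem_cat mem_head orbT.
(* Equal edge sets would force equal vertex sets as well, hence [G1 = G2]. *)
move=> E; apply: G12; apply: val_inj; apply/eqP; rewrite -pair_eqE; apply/andP; split; apply/eqP/setP.
  move=> x; change ((x \in subV G1) = (x \in subV G2)).
  by rewrite -V1 -V2 (lasso_edges_cover n_gt2 _ L1) (lasso_edges_cover n_gt2 _ L2); apply: eq_has_r.
by move=> e; change ((e \in subE G1) = (e \in subE G2)); rewrite -E1 -E2.
Qed.
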